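(* Suppose the model is linear, $q(x,a;\tau)=t(x,a)^\top\tau$ with $\tau\in\mathbb R^{d_\tau}$, where $t$ is a bounded vector of $d_\tau$ linearly independent basis functions not including a constant, and let $g=(\mathcal F(1),\mathcal F(t_1),\dots,\mathcal F(t_{d_\tau}))^\top$ with $\mathrm E[gg^\top]$ nonsingular. Let $(\hat\xi,\hat\tau)$ maximize $\mathrm E_n[\log\{1+\mathcal F(\xi+t^\top\tau)\}]$ over $(\xi,\tau)\in\mathbb R\times\mathbb R^{d_\tau}$ (with $1+\mathcal F(\xi+t^\top\tau)>0$ at all data points), $\hat c=\mathrm E_n[\{1+\mathcal F(\hat\xi+t^\top\hat\tau)\}^{-1}]$ and $\hat\beta_{\mathrm{emp}}=\mathrm E_n[\hat c^{-1}wr/\{1+\mathcal F(\hat\xi+t^\top\hat\tau)\}]$. Then $$\mathrm{Asmse}[\hat\beta_{\mathrm{emp}}]=n^{-1}\min_{\zeta\in\mathbb R,\ \tau\in\mathbb R^{d_\tau}}\Big(\mathrm E\big[\{wr-\mathcal F(\zeta+t^\top\tau)\}^2\big]-{\beta^*}^2\Big).$$ Consequently: (intrinsic efficiency) $\mathrm{Asmse}[\hat\beta_{\mathrm{emp}}]\le\min\{n^{-1}\mathrm{var}(wr),\,n^{-1}\mathrm{var}(w(r-\beta^* )),\,n^{-1}\mathrm{var}(wr-\mathcal F(t^\top\tau^\dagger))\}$ for every $\tau^\dagger\in\mathbb R^{d_\tau}$; and (local efficiency) if $Q(x,a):=\mathrm E[r\mid x,a]=t(x,a)^\top\tau_0$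 for some $\tau_0$, then $\mathrm{Asmse}[\hat\beta_{\mathrm{emp}}]=n^{-1}\mathrm{var}\big(w(r-Q(x,a))+\sum_{a'}Q(x,a')\pi_e(a'|x)\big)$.
   Context: Contextual bandit setting. $\mathcal A$ is a finite action set. The data are $n$ i.i.d. triples $(x^{(i)},a^{(i)},r^{(i)})$, each distributed as $(x,a,r)$ where $x\sim P_0$, $a\mid x\sim\pi_b(\cdot\mid x)$ and $r\mid(x,a)\sim P_r(x,a)$ with $r\in[0,R_{\max}]$. $\pi_e$ is the evaluation policy, overlap holds, and $w=w(x,a)=\pi_e(a|x)/\pi_b(a|x)$ is bounded. $\mathrm E,\mathrm{var}$ are under the behavior distribution, $\mathrm E_n[f]=n^{-1}\sum_{i=1}^n f(x^{(i)},a^{(i)},r^{(i)})$, $\beta^*=\mathrm E[wr]$. For $m:\mathcal X\times\mathcal A\to\mathbb R$, $\mathcal F(m)(x,a)=w(x,a)m(x,a)-\sum_{a'\in\mathcal A}m(x,a')\pi_e(a'|x)$; $1$ denotes the constant function, so $\mathcal F(1)=w-1$. The quantities $n^{-1}\mathrm{var}(wr)$, $n^{-1}\mathrm{var}(w(r-\beta^* ))$, $n^{-1}\mathrm{var}(wr-\mathcal F(q(\cdot;\tau^\dagger)))$ are the asymptotic MSEs of IS $\mathrm E_n[wr]$, SNIS $\mathrm E_n[wr]/\mathrm E_n[w]$, and the DR estimator $\mathrm E_n[wr-\mathcal F(q(\cdot;\tilde\tau))]$ with $\tilde\tau\to\tau^\dagger$ in probability. For $\hat\beta$ with $\sqrt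 n(\hat\beta-\beta^* )\to N(0,\sigma^2)$ in distribution, $\mathrm{Asmse}[\hat\beta]=n^{-1}\sigma^2$. *)

(* Defs.v *)
From HB Require Import structures.
From mathcomp Require Import all_boot all_order all_algebra.
From mathcomp Require Import all_classical all_reals all_analysis.
Set Implicit Arguments.
Unset Strict Implicit.
Unset Printing Implicit Defensive.
Import Order.TTheory GRing.Theory Num.Theory.
Import numFieldNormedType.Exports.
Local Open Scope classical_set_scope.
Local Open Scope ring_scope.

Section defs.
Context {R : realType} {dO : measure_display} {Om : measurableType dO}
  {dX : measure_display} {X : measurableType dX} {A : finType}.

(** A data point is a triple z = (x, a, r) : X * A * R;
    z.1.1 = x (context), z.1.2 = a (action), z.2 = r (reward). *)

Definition Ex (P : probability Om R) (f : Om -> R) : R := fine ('E_P[f])%E.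
Definition Var (P : probability Om R) (f : Om -> R) : R :=
  Ex P (fun w => f w ^+ 2) - (Ex P f) ^+ 2.
Definition Pr (P : probability Om R) (E : set Om) : R := fine (P E).

(** measurable subsets of X * A * R (A carries the discrete sigma-algebra):
    every section at a fixed action is measurable in the product X * R *)
Definition triple_measurable (S : set (X * A * R)) : Prop :=
  forall a : A, measurable [set xr : X * R | S (xr.1, a, xr.2)].

Definition rand_elt_measurable (Z : Om -> X * A * R) : Prop :=
  forall S, triple_measurable S -> measurable (Z @^-1` S).

Definition iid_seq (P : probability Om R) (Z : nat -> Om -> X * A * R) : Prop :=
  [/\ (forall i, rand_elt_measurable (Z i)),
      (forall i S, triple_measurable S -> P (Z i @^-1` S) = P (Z 0 @^-1` S)) &
      (forall (s : seq nat) (S : nat -> set (X * A * R)), uniq s ->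
         (forall i, triple_measurable (S i)) ->
         Pr P (\bigcap_(i in [set i | i \in s]) (Z i @^-1` S i))
         = \prod_(i <- s) Pr P (Z i @^-1` S i))].

Definition policy (pi : X -> A -> R) : Prop :=
  [/\ (forall a, measurable_fun setT (fun x => pi x a)),
      (forall x a, 0 <= pi x a) &
      (forall x, \sum_(a : A) pi x a = 1)].

(** pi_b is the conditional law of the action given the context, for the
    data triple Z0:  P(x in B, a = a0) = E[ 1_B(x) pi_b(a0|x) ] *)
Definition behavior_cond (P : probability Om R) (Z0 : Om -> X * A * R)
    (pi_b : X -> A -> R) : Prop :=
  forall (B : set X) (a0 : A), measurable B ->
    Pr P (Z0 @^-1` [set z | B z.1.1 /\ z.1.2 = a0])
    = Ex P (fun w => \1_B (Z0 w).1.1 * pi_b (Z0 w).1.1 a0).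

Definition cond_mean_reward (P : probability Om R) (Z0 : Om -> X * A * R)
    (Q : X -> A -> R) : Prop :=
  forall (B : set X) (a0 : A), measurable B ->
    Ex P (fun w => (Z0 w).2 * \1_[set z : X * A * R | B z.1.1 /\ z.1.2 = a0] (Z0 w))
    = Ex P (fun w => Q (Z0 w).1.1 (Z0 w).1.2
                     * \1_[set z : X * A * R | B z.1.1 /\ z.1.2 = a0] (Z0 w)).

Definition weight (pi_e pi_b : X -> A -> R) (x : X) (a : A) : R :=
  pi_e x a / pi_b x a.

Definition Fop (pi_e pi_b : X -> A -> R) (m : X -> A -> R) (x : X) (a : A) : R :=
  weight pi_e pi_b x a * m x a - \sum_(a' : A) m x a' * pi_e x a'.

Definition model (d : nat) (t : 'I_d -> X -> A -> R) (xi : R) (tau : 'I_d -> R)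
    (x : X) (a : A) : R :=
  xi + \sum_(j < d) tau j * t j x a.

Definition basis_fn (d : nat) (t : 'I_d -> X -> A -> R) (k : 'I_d.+1)
    (x : X) (a : A) : R :=
  match unlift ord0 k with None => 1 | Some j => t j x a end.

Definition gram (P : probability Om R) (Z0 : Om -> X * A * R)
    (pi_e pi_b : X -> A -> R) (d : nat) (t : 'I_d -> X -> A -> R) : 'M[R]_d.+1 :=
  \matrix_(k, l) Ex P (fun w =>
      Fop pi_e pi_b (basis_fn t k) (Z0 w).1.1 (Z0 w).1.2
    * Fop pi_e pi_b (basis_fn t l) (Z0 w).1.1 (Z0 w).1.2).

Definition lin_indep_with_const (d : nat) (t : 'I_d -> X -> A -> R) : Prop :=
  forall (c0 : R) (c : 'I_d -> R),
    (forall x a, c0 + \sum_(j < d) c j * t j x a = 0) ->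
    c0 = 0 /\ forall j, c j = 0.

Definition Emp (Z : nat -> Om -> X * A * R) (n : nat) (h : X * A * R -> R)
    (w : Om) : R :=
  n%:R^-1 * \sum_(i < n) h (Z i w).

Definition onepF (pi_e pi_b : X -> A -> R) (d : nat) (t : 'I_d -> X -> A -> R)
    (xi : R) (tau : 'I_d -> R) (z : X * A * R) : R :=
  1 + Fop pi_e pi_b (model t xi tau) z.1.1 z.1.2.

Definition emp_loglik (Z : nat -> Om -> X * A * R) (pi_e pi_b : X -> A -> R)
    (d : nat) (t : 'I_d -> X -> A -> R) (n : nat) (xi : R) (tau : 'I_d -> R)
    (w : Om) : R :=
  Emp Z n (fun z => ln (onepF pi_e pi_b t xi tau z)) w.

Definition emp_feasible (Z : nat -> Om -> X * A * R) (pi_e pi_b : X -> A -> R)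
    (d : nat) (t : 'I_d -> X -> A -> R) (n : nat) (xi : R) (tau : 'I_d -> R)
    (w : Om) : Prop :=
  forall i, (i < n)%N -> 0 < onepF pi_e pi_b t xi tau (Z i w).

Definition is_emp_max (Z : nat -> Om -> X * A * R) (pi_e pi_b : X -> A -> R)
    (d : nat) (t : 'I_d -> X -> A -> R) (n : nat) (xi : R) (tau : 'I_d -> R)
    (w : Om) : Prop :=
  emp_feasible Z pi_e pi_b t n xi tau w /\
  forall xi' tau', emp_feasible Z pi_e pi_b t n xi' tau' w ->
    emp_loglik Z pi_e pi_b t n xi' tau' w <= emp_loglik Z pi_e pi_b t n xi tau w.

Definition beta_emp (Z : nat -> Om -> X * A * R) (pi_e pi_b : X -> A -> R)
    (d : nat) (t : 'I_d -> X -> A -> R) (n : nat) (xi : R) (tau : 'I_d -> R)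
    (w : Om) : R :=
  let c := Emp Z n (fun z => (onepF pi_e pi_b t xi tau z)^-1) w in
  Emp Z n (fun z => c^-1 * weight pi_e pi_b z.1.1 z.1.2 * z.2
                    / onepF pi_e pi_b t xi tau z) w.

(** E[f(Y)] for Y ~ N(0, s2) (s2 = 0: the Dirac mass at 0) *)
Definition gauss_mean (s2 : R) (f : R -> R) : R :=
  if s2 == 0 then f 0
  else fine (\int[normal_prob 0 (Num.sqrt s2)]_y (f y)%:E)%E.

Definition cvg_dist_normal (P : probability Om R) (Y : nat -> Om -> R) (s2 : R) : Prop :=
  forall f : R -> R, continuous f -> (exists M, forall y, `|f y| <= M) ->
    (fun n => Ex P (fun w => f (Y n w))) @ \oo --> gauss_mean s2 f.

End defs.

(* Main.v *)
Require Import Defs.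
From HB Require Import structures.
From mathcomp Require Import all_boot all_order all_algebra.
From mathcomp Require Import all_classical all_reals all_analysis.
From mathcomp Require Import measurable_realfun ring lra.
Import Order.TTheory GRing.Theory Num.Theory.
Import numFieldNormedType.Exports.
Local Open Scope classical_set_scope.
Local Open Scope ring_scope.

(** Write [g = (F(1), F(t_1), ..., F(t_d))] and [q = w r]. The first-order
    condition at an interior maximizer [eta] reads [E_n[g / (1 + eta.g)] = 0];
    pairing it with [eta] gives [c = 1] exactly, and expanding
    [1 / (1 + y) = 1 - y + y^2 / (1 + y)] gives, with no consistency argument,
    [eta = O(|E_n g|)] and
    [beta_emp = E_n[q - b.g] + O(|E_n g|^2 + ...)], where [b = G^-1 E[q g]] and
    [G = E[g g^T]]. Since [E g = 0], the limit variance is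
    [E (q - b.g)^2 - beta^2], the least-squares minimum over the span of [g]; the
    competing estimators correspond to particular coefficients, and under the
    linear reward model [tau_0] solves the normal equations.

    The central limit theorem for bounded variables is obtained by Stein's
    method: a continuous compactly supported [D] of Gaussian mean zero is
    [s^2 phi' - x phi] with [phi] again compactly supported, so that a Taylor
    expansion of [E (S phi(S))], removing one summand at a time, gives
    [E D(S_n) -> 0]; Chebyshev's inequality supplies tightness. *)

(** The obstacle is that the weights 1 / (1 + eta.g) have no a priori bound: feasibility only makes
    them positive at the data. A sign replaces the bound. With y = eta.g the term y^2 / (1 + y) is
    nonnegative, and since E_n[y / (1 + y)] = 0 its empirical mean equals E_n y = eta.E_n g. So each
    second-order remainder against a bounded function is at most a constant times |eta| |E_n g|, and
    feeding this back into the first-order condition bounds eta itself. All this is an inequality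
    about real sequences at a fixed outcome, valid where a maximizer exists and the empirical means
    of g, g g^T and q g are close to their limits. Randomness enters only through the mean square of
    these deviations, which is of order 1/n. *)

Set Implicit Arguments.
Unset Strict Implicit.
Unset Printing Implicit Defensive.

(** * Bounded measurable functions, and functionals determined by indicators *)

Section bounded_measurable.
Context {d} {T : measurableType d} {R : realType}.
Implicit Types f g : T -> R.

Definition bmeas f := measurable_fun [set: T] f /\ exists M : R, forall x, `|f x| <= M.

Lemma bmeas_cst (c : R) : bmeas (fun=> c).
Proof. by split; [exact: measurable_cst|exists `|c|]. Qed.

Lemma bmeasD f g : bmeas f -> bmeas g -> bmeas (fun x => f x + g x).
Proof.
move=> [mf [M fM]] [mg [N gN]]; split; first exact: measurable_funD.
by exists (M + N) => x; rewrite (le_trans (ler_normD _ _))// lerD.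
Qed.

Lemma bmeasM f g : bmeas f -> bmeas g -> bmeas (fun x => f x * g x).
Proof.
move=> [mf [M fM]] [mg [N gN]]; split; first exact: measurable_funM.
by exists (M * N) => x; rewrite normrM ler_pM.
Qed.

Lemma bmeasZ (c : R) f : bmeas f -> bmeas (fun x => c * f x).
Proof. by move=> bf; apply: bmeasM => //; exact: bmeas_cst. Qed.

Lemma bmeasN f : bmeas f -> bmeas (fun x => - f x).
Proof.
move=> /(bmeasZ (-1)) bf.
by rewrite (_ : (fun x => _) = fun x => -1 * f x)//; apply/funext => x; rewrite mulN1r.
Qed.

Lemma bmeasB f g : bmeas f -> bmeas g -> bmeas (fun x => f x - g x).
Proof. by move=> bf /bmeasN; exact: bmeasD. Qed.

Lemma bmeasX f n : bmeas f -> bmeas (fun x => f x ^+ n).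
Proof.
move=> [mf [M fM]]; split; first exact: measurable_funX.
by exists (M ^+ n) => x; rewrite normrX lerXn2r ?nnegrE// (le_trans _ (fM x)).
Qed.

Lemma bmeas_norm f : bmeas f -> bmeas (fun x => `|f x|).
Proof.
move=> [mf [M fM]]; split; first exact: measurableT_comp.
by exists M => x; rewrite normr_id.
Qed.

Lemma bmeas_sum I (r : seq I) (p : pred I) (f : I -> T -> R) :
  (forall i, bmeas (f i)) -> bmeas (fun x => \sum_(i <- r | p i) f i x).
Proof.
move=> bf; elim: r => [|i r IH].
  under eq_fun do rewrite big_nil; exact: bmeas_cst.
under eq_fun do rewrite big_cons.
by case: (p i) => //; exact: bmeasD.
Qed.

Lemma bmeas_indic (B : set T) : measurable B -> bmeas (\1_B : T -> R).
Proof.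
move=> mB; split; first exact: measurable_indic.
by exists 1 => x; rewrite indicE; case: (_ \in _); rewrite ?normr1 ?normr0.
Qed.

(** Linearity with continuity in the sup norm. No sign is imposed, so expectations against a signed
    bounded factor qualify. *)
Definition bfunctional (L : (T -> R) -> R) :=
  [/\ forall f g, bmeas f -> bmeas g -> L (fun x => f x + g x) = L f + L g,
      forall c f, bmeas f -> L (fun x => c * f x) = c * L f &
      exists2 C : R, 0 <= C & forall f (e : R), bmeas f -> (forall x, `|f x| <= e) ->
        `|L f| <= C * e].

(* Layer cake: subtracting [del] on [del <= f] lowers the range of [f] by one
   layer without changing [L1 f - L2 f]. *)
Lemma bfunctional_eq (L1 L2 : (T -> R) -> R) : bfunctional L1 -> bfunctional L2 ->
  (forall B, measurable B -> L1 \1_B = L2 \1_B) ->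
  forall f, bmeas f -> L1 f = L2 f.
Proof.
move=> [L1D L1Z [C1 C10 L1C]] [L2D L2Z [C2 C20 L2C]] L12.
have layer (del : R) (N : nat) : 0 < del -> forall f, bmeas f ->
    (forall x, 0 <= f x <= N.+1%:R * del) -> `|L1 f - L2 f| <= (C1 + C2) * del.
  move=> del0; elim: N => [|N IH] f bf f0.
    have fdel x : `|f x| <= del.
      by have /andP[? ?] := f0 x; rewrite ger0_norm// -[leRHS]mul1r.
    rewrite (le_trans (ler_normB _ _))// mulrDl lerD//; first exact: L1C.
    exact: L2C.
  pose B := [set x | del <= f x].
  have mB : measurable B.
    rewrite (_ : B = f @^-1` `[del, +oo[%classic); last first.
      by apply/seteqP; split => x; rewrite /B /= in_itv/= andbT.
    by rewrite -[X in measurable X]setTI; apply: (proj1 bf).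
  have bB : bmeas (fun x => - del * \1_B x) by apply: bmeasZ; exact: bmeas_indic.
  have -> : L1 f - L2 f = L1 (fun x => f x + - del * \1_B x)
                        - L2 (fun x => f x + - del * \1_B x).
    rewrite L1D// L2D// L1Z; last exact: bmeas_indic.
    by rewrite L2Z; [rewrite L12//; ring|exact: bmeas_indic].
  apply: IH => [|x]; first exact: bmeasD.
  have /andP[f0x fNx] := f0 x.
  rewrite indicE; case: (boolP (x \in B)) => [/set_mem|/negP xB].
    by rewrite /B /= => ?; rewrite -[N.+2%:R]natr1 in fNx; lra.
  have : f x < del by rewrite ltNge; apply/negP => H; apply: xB; apply/mem_set.
  have := mulr_ge0 (ler0n R N) (ltW del0); rewrite -[N.+1%:R]natr1 mulr0; lra.
move=> f bf; apply/eqP; rewrite -subr_eq0; apply/negPn/negP => ne.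
have [M fM] := proj2 bf.
have /= := layer.
have M0 : 0 <= M by exact: le_trans (fM point).
set a : R := `|L1 f - L2 f|; have a0 : 0 < a by rewrite normr_gt0.
(* This layer height makes (C1 + C2) del strictly smaller than [a]; the + 1 covers C1 = C2 = 0.
   Below, adding [M] to [f] moves its values into [0, 2 M]. *)
pose del : R := a / (2 * (C1 + C2 + 1)).
have del0 : 0 < del by rewrite divr_gt0// mulr_gt0// -addrA ltr_wpDl// ltr_wpDl.
have [N HN] : exists N : nat, 2 * M <= N.+1%:R * del.
  exists (Num.truncn (2 * M / del)); rewrite -ler_pdivrMr//.
  by apply: ltW; rewrite truncnS_gt.
move=> /(_ del N del0 (fun x => f x + M)).
have bM : bmeas (fun x : T => M) by exact: bmeas_cst.
rewrite L1D// L2D//.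
have -> : L1 (fun=> M) = L2 (fun=> M).
  have -> : (fun=> M) = (fun x : T => M * \1_setT x).
    by apply/funext => x; rewrite indicE in_setT mulr1.
  by rewrite L1Z ?L2Z ?L12//; exact: bmeas_indic.
have -> : L1 f + L2 (fun=> M) - (L2 f + L2 (fun=> M)) = L1 f - L2 f by ring.
move=> /(_ (bmeasD bf bM)) H.
have : a <= (C1 + C2) * del.
  apply: H => x; have := fM x; rewrite ler_norml => /andP[? ?]; lra.
have : a = 2 * (C1 + C2 + 1) * del by rewrite /del mulrC divfK// gt_eqF; lra.
nra.
Qed.

End bounded_measurable.

Lemma bmeas_comp d d' (T : measurableType d) (T' : measurableType d') (R : realType)
    (f : T -> R) (k : T' -> T) :
  bmeas f -> measurable_fun [set: T'] k -> bmeas (fun x => f (k x)).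
Proof.
move=> [mf [M fM]] mk; split; first exact: measurableT_comp.
by exists M => x.
Qed.

(** * Expectations of bounded functions *)

Section expectation.
Context {R : realType} {dO : measure_display} {Om : measurableType dO}.
Variable P : probability Om R.
Implicit Types f g : Om -> R.

Lemma bmeas_integrable f : bmeas f -> P.-integrable setT (EFin \o f).
Proof.
move=> [mf [M fM]].
apply: (@measurable_bounded_integrable _ _ _ P) => //.
  by rewrite [X in (X < _)%E](@probability_setT _ _ _ P) ltry.
exists M; split; first exact: num_real.
by move=> y My x _; apply: (le_trans (fM x)); exact: ltW.
Qed.

Lemma ExE f : Ex P f = (\int[P]_x f x)%R.
Proof. by rewrite /Ex unlock. Qed.

Lemma Ex_cst (c : R) : Ex P (fun=> c) = c.
Proof. by rewrite /Ex expectation_cst. Qed.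

Lemma ExD f g : bmeas f -> bmeas g -> Ex P (fun x => f x + g x) = Ex P f + Ex P g.
Proof. by move=> /bmeas_integrable bf /bmeas_integrable bg; rewrite !ExE RintegralD. Qed.

Lemma ExZ c f : bmeas f -> Ex P (fun x => c * f x) = c * Ex P f.
Proof. by move=> /bmeas_integrable bf; rewrite !ExE RintegralZl. Qed.

Lemma ExB f g : bmeas f -> bmeas g -> Ex P (fun x => f x - g x) = Ex P f - Ex P g.
Proof. by move=> /bmeas_integrable bf /bmeas_integrable bg; rewrite !ExE RintegralB. Qed.

Lemma Ex_sum I (r : seq I) (p : pred I) (f : I -> Om -> R) :
  (forall i, bmeas (f i)) ->
  Ex P (fun x => \sum_(i <- r | p i) f i x) = \sum_(i <- r | p i) Ex P (f i).
Proof.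
move=> bf; elim: r => [|i r IH].
  by rewrite big_nil; under eq_fun do rewrite big_nil; rewrite Ex_cst.
rewrite big_cons; under eq_fun do rewrite big_cons.
by case: (p i) => //; rewrite ExD// ?IH//; exact: bmeas_sum.
Qed.

Lemma Ex_le f g : bmeas f -> bmeas g -> (forall x, f x <= g x) -> Ex P f <= Ex P g.
Proof.
by move=> /bmeas_integrable bf /bmeas_integrable bg fg; rewrite !ExE le_Rintegral.
Qed.

Lemma Ex_ge0 f : (forall x, 0 <= f x) -> 0 <= Ex P f.
Proof. by move=> f0; rewrite ExE Rintegral_ge0. Qed.

Lemma Ex_norm f : bmeas f -> `|Ex P f| <= Ex P (fun x => `|f x|).
Proof. by move=> /bmeas_integrable bf; rewrite !ExE le_normr_Rintegral. Qed.

Lemma Ex_bound f e : bmeas f -> (forall x, `|f x| <= e) -> `|Ex P f| <= e.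
Proof.
move=> bf fe; rewrite (le_trans (Ex_norm _))// -[leRHS]Ex_cst Ex_le//.
  exact: bmeas_norm.
exact: bmeas_cst.
Qed.

Lemma Ex_indic B : measurable B -> Ex P \1_B = Pr P B.
Proof. by move=> mB; rewrite /Ex expectation_indic. Qed.

Lemma Pr_bound B : measurable B -> 0 <= Pr P B <= 1.
Proof.
move=> mB; rewrite -Ex_indic//; apply/andP; split.
  by apply: Ex_ge0 => x; rewrite indicE.
rewrite -[leRHS]Ex_cst; apply: Ex_le => [||x].
- exact: bmeas_indic.
- exact: bmeas_cst.
- by rewrite indicE; case: (_ \in _).
Qed.

(** The factor [h] holds the part of an integrand kept fixed (an event, a policy probability, a
    reward on one action) while [f] is varied by [bfunctional_eq]. *)
Lemma bfunctional_Ex d (T : measurableType d) (k : Om -> T) (h : Om -> R) :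
  measurable_fun setT k -> bmeas h ->
  bfunctional (fun f : T -> R => Ex P (fun w => f (k w) * h w)).
Proof.
move=> mk bh.
have bk (f : T -> R) : bmeas f -> bmeas (fun w => f (k w)).
  by move=> bf; exact: bmeas_comp bf mk.
split=> [f g bf bg|c f bf|].
- rewrite -ExD; [|by apply: bmeasM => //; exact: bk..].
  by congr Ex; apply/funext => w; rewrite mulrDl.
- rewrite -ExZ; last by apply: bmeasM => //; exact: bk.
  by congr Ex; apply/funext => w; rewrite mulrA.
- have [M hM] := proj2 bh; exists `|M| => // f e bf fe.
  apply: Ex_bound => [|w]; first by apply: bmeasM => //; exact: bk.
  rewrite normrM mulrC ler_pM//; exact: le_trans (hM _) (ler_norm _).
Qed.

End expectation.

(** * Independence, passed from events to bounded functions *)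

Section independence.
Context {R : realType} {dO : measure_display} {Om : measurableType dO}.
Variable P : probability Om R.

Record iid_bounded (U : nat -> Om -> R) : Prop := IidBounded {
  iidb_meas : forall i, measurable_fun [set: Om] (U i);
  iidb_bound : exists M : R, forall i w, `|U i w| <= M;
  iidb_dist : forall i B, measurable B -> Pr P (U i @^-1` B) = Pr P (U 0%N @^-1` B);
  iidb_indep : forall (s : seq nat) (B : nat -> set R), uniq s ->
    (forall i, measurable (B i)) ->
    Pr P (\bigcap_(i in [set i | i \in s]) (U i @^-1` B i))
    = \prod_(i <- s) Pr P (U i @^-1` B i) }.

Variable U : nat -> Om -> R.
Hypothesis iidU : iid_bounded U.

Let mU i : measurable_fun [set: Om] (U i) := iidb_meas iidU i.

Lemma iidb_bmeas i : bmeas (U i).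
Proof. by split=> //; have [M UM] := iidb_bound iidU; exists M. Qed.

Lemma iidb_pre i (B : set R) : measurable B -> measurable (U i @^-1` B).
Proof. by move=> mB; rewrite -[X in measurable X]setTI; exact: mU. Qed.

(** A pi-system generating the sigma-algebra of the [U j] with [j] in [s]. *)
Definition cylinders (s : seq nat) : set (set Om) :=
  [set C | exists2 B : nat -> set R, (forall i, measurable (B i)) &
     C = \bigcap_(i in [set i | i \in s]) (U i @^-1` B i)].

Lemma cylinders_setI s : setI_closed (cylinders s).
Proof.
move=> _ _ [B mB ->] [C mC ->]; exists (fun i => B i `&` C i).
  by move=> i; exact: measurableI.
by rewrite -bigcapI.
Qed.

Lemma cylinders_measurable s : cylinders s `<=` measurable.
Proof.
move=> _ [B mB ->]; apply: bigcap_measurableType => //.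
by move=> i _; exact: iidb_pre.
Qed.

(** Both sides are finite measures in [C], here [m1] and [m2]. Independence along [i :: s] makes
    them agree on the pi-system of cylinders, hence on the sigma-algebra it generates. *)
Lemma Pr_indep_cylinder i s (B : set R) C : uniq s -> i \notin s -> measurable B ->
  <<s cylinders s >> C -> Pr P (U i @^-1` B `&` C) = Pr P (U i @^-1` B) * Pr P C.
Proof.
move=> us is_ mB sC.
have mUB := iidb_pre i mB.
have pUB : 0 <= Pr P (U i @^-1` B) by have /andP[] := Pr_bound P mUB.
pose m1 : {measure set Om -> \bar R} := mrestr P mUB.
pose m2 : {measure set Om -> \bar R} := mscale (NngNum pUB) P.
have mcyl := @cylinders_measurable s.
have cT : cylinders s setT.
  by exists (fun=> setT) => //; apply/seteqP; split => // w _ j _.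
have m12 : m1 C = m2 C.
  apply: (@g_sigma_algebra_measure_unique _ _ _ (cylinders s) _ (fun=> setT)) => //.
  - exact: bigcup_const.
  - exact: cylinders_setI.
  - move=> D cD; have mD := mcyl _ cD.
    have pD : P (D `&` U i @^-1` B) = (Pr P (U i @^-1` B) * Pr P D)%:E.
      rewrite -[LHS]fineK ?fin_num_measure//; last exact: measurableI.
      congr EFin; rewrite setIC; case: cD mD => B' mB' -> mD.
      (* The family puts [B] at [i] and [B'] elsewhere; since [i] is not in [s], the cylinder over
         [s] is unchanged. *)
      have := iidb_indep iidU (s := i :: s) (B := fun j => if j == i then B else B' j).
      have := iidb_indep iidU us mB'.
      rewrite /Pr => -> /= /(_ _ _)/wrap[].
      - by rewrite is_ us.
      - by move=> j; case: eqP.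
      rewrite !(bigcap_seq (_ :: _)) !(bigcap_seq s) !big_cons eqxx => H.
      rewrite -(_ : \big[setI/setT]_(j <- s) (U j @^-1` (if j == i then B else B' j))
                  = \big[setI/setT]_(j <- s) (U j @^-1` B' j)) ?H; last first.
        by apply: eq_big_seq => j js; case: eqP => // ji; rewrite -ji js in is_.
      by congr (_ * _); apply: eq_big_seq => j js; case: eqP => // ji; rewrite -ji js in is_.
    by rewrite /m1 /m2 /= /mrestr /mscale /= pD EFinM; congr (_ * _)%E;
      rewrite /Pr fineK// fin_num_measure.
  - by move=> n; rewrite /m1/= /mrestr setTI (le_lt_trans (probability_le1 P mUB)) ?ltry.
have mC : measurable C.
  exact: (smallest_sub (@sigma_algebra_measurable _ Om) mcyl).
move: m12; rewrite /m1 /m2 /= /mrestr /mscale /= /Pr setIC => ->.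
by rewrite fineM ?fin_num_measure.
Qed.

(** The outcomes with a smaller sigma-algebra: [bmeas] on this type expresses dependence on the
    coordinates in [s] alone. *)
Let GT s := g_sigma_algebraType (cylinders s).

Lemma measurable_id_cylinders s : measurable_fun [set: Om] (id : Om -> GT s).
Proof.
move=> _ C mC; rewrite setTI preimage_id.
by apply: (smallest_sub (@sigma_algebra_measurable _ Om) (@cylinders_measurable s)).
Qed.

Lemma measurable_cylinders s j : j \in s ->
  measurable_fun [set: GT s] (U j : GT s -> R).
Proof.
move=> js _ B mB; rewrite setTI; apply: sub_sigma_algebra.
exists (fun k => if k == j then B else setT).
  by move=> k; case: ifP.
apply/seteqP; split => [w Bw k _ /=|w /(_ _ js)/=]; last by rewrite eqxx.
by case: eqP => // ->.
Qed.

(** Two passes of [bfunctional_eq]: with an event [C] of the other coordinates fixed, [F] is reduced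
    to an indicator; then, with [F] fixed, [H] is. *)
Lemma Ex_indep_bmeas i s (F : R -> R) (H : GT s -> R) : uniq s -> i \notin s ->
  bmeas F -> bmeas H ->
  Ex P (fun w => F (U i w) * H w) = Ex P (fun w => F (U i w)) * Ex P H.
Proof.
move=> us is_ bF bH.
have bFU : bmeas (fun w => F (U i w)) by exact: bmeas_comp bF (mU i).
have step1 (C : set Om) : <<s cylinders s >> C ->
    Ex P (fun w => F (U i w) * \1_C w) = Ex P (fun w => F (U i w) * Pr P C).
  move=> sC; have mC : measurable C.
    exact: (smallest_sub (@sigma_algebra_measurable _ Om) (@cylinders_measurable s)).
  apply: (bfunctional_eq (L1 := fun F : R -> R => Ex P (fun w => F (U i w) * \1_C w))
    (L2 := fun F : R -> R => Ex P (fun w => F (U i w) * Pr P C)) _ _ _ bF).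
  - by apply: bfunctional_Ex => //; exact: bmeas_indic.
  - by apply: bfunctional_Ex => //; exact: bmeas_cst.
  - move=> B mB; have mUB := iidb_pre i mB.
    rewrite (_ : (fun w => _ * \1_C w) = \1_(U i @^-1` B `&` C)); last first.
      by apply/funext => w; rewrite indicI.
    rewrite (_ : (fun w => _ * Pr P C) = (fun w => Pr P C * \1_(U i @^-1` B) w)); last first.
      by apply/funext => w; rewrite mulrC.
    rewrite ExZ; last exact: bmeas_indic.
    rewrite !Ex_indic//; last exact: measurableI.
    by rewrite (Pr_indep_cylinder us is_ mB sC) mulrC.
rewrite (_ : Ex P (fun w => F (U i w) * H w) = Ex P (fun w => H w * F (U i w))); last first.
  by congr Ex; apply/funext => w; rewrite mulrC.
have -> : Ex P (fun w => H w * F (U i w)) = Ex P (fun w => H w * Ex P (fun w => F (U i w))).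
  apply: (bfunctional_eq (L1 := fun H : GT s -> R => Ex P (fun w => H w * F (U i w)))
    (L2 := fun H : GT s -> R => Ex P (fun w => H w * Ex P (fun w => F (U i w)))) _ _ _ bH).
  - exact: (bfunctional_Ex P (@measurable_id_cylinders s)).
  - by apply: (bfunctional_Ex P (@measurable_id_cylinders s)); exact: bmeas_cst.
  - move=> C mC.
    have mC' : measurable (C : set Om).
      exact: (smallest_sub (@sigma_algebra_measurable _ Om) (@cylinders_measurable s)).
    under eq_fun do rewrite mulrC.
    rewrite step1//.
    under eq_fun do rewrite mulrC.
    under [in RHS]eq_fun do rewrite mulrC.
    rewrite !ExZ//; last exact: bmeas_indic.
    rewrite [LHS]mulrC; congr (_ * _); exact: esym (Ex_indic P mC').
under eq_fun do rewrite mulrC.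
rewrite ExZ//; exact: bmeas_comp bH (@measurable_id_cylinders s).
Qed.

(** The identity and the square are unbounded on the line but bounded along the data; clipping makes
    them [bmeas] without changing their values there. *)
Let clip (K : R) (F : R -> R) (u : R) := F u * \1_[set v | `|F v| <= K] u.

Let clip_bmeas K F : measurable_fun [set: R] F -> bmeas (clip K F).
Proof.
move=> mF; have mK : measurable [set v | `|F v| <= K].
  rewrite (_ : [set v | _] = (fun v => `|F v|) @^-1` `]-oo, K]%classic); last first.
    by apply/seteqP; split => x; rewrite /= in_itv.
  by rewrite -[X in measurable X]setTI; apply: measurableT_comp.
split; first by apply: measurable_funM => //; exact: measurable_indic.
exists `|K| => u; rewrite /clip indicE; case: (boolP (u \in _)) => [/set_mem /= FK|_].
  by rewrite mulr1 (le_trans FK)// ler_norm.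
by rewrite mulr0 normr0.
Qed.

Let clipE K F u : `|F u| <= K -> clip K F u = F u.
Proof. by move=> FK; rewrite /clip indicE mem_set ?mulr1. Qed.

Lemma Ex_indep_sum i s (F G : R -> R) (c : R) : uniq s -> i \notin s ->
  measurable_fun [set: R] F -> (exists K : R, forall w, `|F (U i w)| <= K) ->
  bmeas G ->
  Ex P (fun w => F (U i w) * G (c * \sum_(j <- s) U j w)) =
  Ex P (fun w => F (U i w)) * Ex P (fun w => G (c * \sum_(j <- s) U j w)).
Proof.
move=> us is_ mF [K FK] bG.
have cE : (fun w => F (U i w)) = (fun w => clip K F (U i w)).
  by apply/funext => w; rewrite clipE.
under eq_fun do rewrite (congr1 (@^~ _) cE).
rewrite cE; apply: (Ex_indep_bmeas us is_ (clip_bmeas K mF)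
  (H := fun w => G (c * \sum_(j <- s) U j w))).
apply: bmeas_comp bG _; apply: measurable_funM => //.
have H r : {subset r <= s} ->
    measurable_fun [set: GT s] (fun w => \sum_(j <- r) U j w).
  elim: r => [|j r IH] rs.
    by under eq_fun do rewrite big_nil; exact: measurable_cst.
  under eq_fun do rewrite big_cons.
  apply: measurable_funD; first by apply: measurable_cylinders; rewrite rs ?mem_head.
  by apply: IH => k kr; rewrite rs// inE kr orbT.
exact: H.
Qed.

Lemma Ex_iid i (F : R -> R) :
  measurable_fun [set: R] F -> (exists K : R, forall j w, `|F (U j w)| <= K) ->
  Ex P (fun w => F (U i w)) = Ex P (fun w => F (U 0%N w)).
Proof.
move=> mF [K FK].
have cE j : (fun w => F (U j w)) = (fun w => clip K F (U j w) * 1).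
  by apply/funext => w; rewrite clipE// mulr1.
rewrite !cE.
apply: (bfunctional_eq (L1 := fun F : R -> R => Ex P (fun w => F (U i w) * 1))
  (L2 := fun F : R -> R => Ex P (fun w => F (U 0%N w) * 1))).
- by apply: bfunctional_Ex => //; exact: bmeas_cst.
- by apply: bfunctional_Ex => //; exact: bmeas_cst.
- move=> B mB; have E j : (fun w => \1_B (U j w) * 1) = \1_(U j @^-1` B) :> (Om -> R).
    by apply/funext => w; rewrite mulr1.
  by rewrite !E !Ex_indic; [exact: iidb_dist|exact: iidb_pre|exact: iidb_pre].
- exact: clip_bmeas.
Qed.

Lemma Ex_indep2 i j : i != j ->
  Ex P (fun w => U i w * U j w) = Ex P (U i) * Ex P (U j).
Proof.
move=> ij; have [M UM] := iidb_bound iidU.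
have := @Ex_indep_sum i [:: j] id (clip M id) 1 erefl.
rewrite inE => /(_ ij)/(_ (@measurable_id _ _ _)).
move=> /(_ (ex_intro _ M (UM i)))/(_ (clip_bmeas M (@measurable_id _ _ _))).
have E w : clip M id (1 * \sum_(j0 <- [:: j]) U j0 w) = U j w.
  by rewrite big_seq1 mul1r clipE.
by under eq_fun do rewrite E; under [X in _ * Ex _ X]eq_fun do rewrite E.
Qed.

(* Only the diagonal terms of the squared sum survive. *)
Lemma Ex_mean_sqr n : Ex P (U 0%N) = 0 ->
  Ex P (fun w => (n%:R^-1 * \sum_(i < n) U i w) ^+ 2)
  = n%:R^-1 * Ex P (fun w => U 0%N w ^+ 2).
Proof.
move=> U0; have [M UM] := iidb_bound iidU.
have EU i : Ex P (U i) = 0.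
  rewrite -U0; apply: (@Ex_iid i id); first exact: measurable_id.
  by exists M.
have EU2 i : Ex P (fun w => U i w ^+ 2) = Ex P (fun w => U 0%N w ^+ 2).
  apply: (@Ex_iid i (fun u => u ^+ 2)); first exact: measurable_funX.
  by exists (M ^+ 2) => j w; rewrite normrX lerXn2r ?nnegrE// (le_trans _ (UM j w)).
under eq_fun do rewrite exprMn expr2 (expr2 (\sum_(_ < _) _)) big_distrlr/=.
rewrite ExZ; last first.
  by apply: bmeas_sum => i; apply: bmeas_sum => j; apply: bmeasM; exact: iidb_bmeas.
rewrite Ex_sum; last first.
  by move=> i; apply: bmeas_sum => j; apply: bmeasM; exact: iidb_bmeas.
under eq_bigr => i _.
  rewrite Ex_sum; last by move=> j; apply: bmeasM; exact: iidb_bmeas.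
  rewrite (bigD1 i)//= big1 ?addr0; last first.
    by move=> j ji; rewrite Ex_indep2 ?EU ?mul0r// eq_sym.
  rewrite (_ : (fun w => U i w * U i w) = (fun w => U i w ^+ 2)); last first.
    by apply/funext => w; rewrite expr2.
  rewrite EU2; over.
rewrite sumr_const card_ord -[X in _ * X]mulr_natl !mulrA -mulrA.
have [->|n0] := eqVneq n 0%N; first by rewrite invr0 !mul0r.
by rewrite mulrA mulfVK// pnatr_eq0.
Qed.

End independence.

(** * Compactly supported test functions *)

Section compactly_supported.
Context {R : realType}.
Implicit Types f : R -> R.

Definition supported f (M : R) := forall x, M <= `|x| -> f x = 0.

Lemma supported_bounded f M : continuous f -> supported f M ->
  exists K : R, forall x, `|f x| <= K.
Proof.
move=> cf fM; have M0 : - (`|M| + 1) <= `|M| + 1 by have := normr_ge0 M; lra.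
have [] := @EVT_max R (fun x => `|f x|) _ _ M0.
  apply: continuous_subspaceT => x; apply: continuous_comp; first exact: cf.
  exact: norm_continuous.
move=> c _ fc; exists `|f c| => x.
have [xM|xM] := leP M `|x|; first by rewrite fM// normr0.
apply: fc; rewrite in_itv/= -ler_norml (le_trans (ltW xM))//.
by rewrite (le_trans (ler_norm _))// lerDl.
Qed.

Definition unif_cont f := forall e : R, 0 < e -> exists2 del : R, 0 < del &
  forall x y, `|x - y| < del -> `|f x - f y| <= e.

(** Compactness of [-M, M] gives one radius for all its points. A pair with one point in the segment
    is covered by symmetry, and for the others both values are zero. *)
Lemma supported_unif_cont f M : continuous f -> supported f M -> unif_cont f.
Proof.
move=> cf fM e e0.
pose K : set R := `[- M, M]%classic.
have cK : compact K by exact: segment_compact.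
have /compact_near_coveringP nc := cK.
have : \forall d \near 0^'+, K `<=` [set x | forall y, `|x - y| < d -> `|f x - f y| <= e].
  apply: nc.
  move=> x _; have e20 : 0 < e / 2 by rewrite divr_gt0.
  have /cvgrPdist_le/(_ _ e20)[r /= r0 fr] := cf x.
  exists (ball x (r / 2), [set d | 0 < d < r / 2]) => /=.
    split; first by apply: nbhsx_ballx; rewrite divr_gt0.
    near=> d; apply/andP; split; first by near: d; exact: nbhs_right_gt.
    by near: d; apply: nbhs_right_lt; rewrite divr_gt0.
  move=> [x' d] /= [xx' /andP[d0 dr]] y x'y.
  have H1 : `|f x - f x'| <= e / 2 by apply: fr; rewrite /= (lt_le_trans xx')//; lra.
  have H2 : `|f x - f y| <= e / 2.
    apply: fr; rewrite /= -(subrK x' x) -addrA (le_lt_trans (ler_normD _ _))//.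
    by rewrite /ball /= in xx'; lra.
  rewrite -(subrK (f x) (f x')) -addrA (le_trans (ler_normD _ _))// distrC.
  lra.
move=> [r /= r0 fr].
have Pr x y : `|x| <= M -> `|x - y| < r / 2 -> `|f x - f y| <= e.
  move=> xM xy; apply: (fr (r / 2)) => //=.
  - by rewrite sub0r normrN gtr0_norm ?divr_gt0//; lra.
  - by rewrite divr_gt0.
  - by rewrite /K /= in_itv/= -ler_norml.
exists (r / 2); first by rewrite divr_gt0.
move=> x y xy; have [xM|xM] := leP `|x| M; first exact: Pr.
have [yM|yM] := leP `|y| M; first by rewrite distrC Pr// distrC.
by rewrite !fM; [rewrite subrr normr0 ltW|exact: ltW..].
Unshelve. all: by end_near. Qed.

Lemma supported_bmeas f M : continuous f -> supported f M -> bmeas f.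
Proof.
move=> cf fM; split; first exact: continuous_measurable_fun.
exact: supported_bounded fM.
Qed.

(** A continuous cutoff, 1 on [-M, M] and 0 beyond M + 1, so that tightness is expressed by
    expectations of continuous functions. *)
Definition trapezoid (M x : R) : R := Num.min 1 (Num.max 0 (M + 1 - `|x|)).

Lemma trapezoid_continuous M : continuous (trapezoid M).
Proof.
rewrite (_ : trapezoid M = cst 1 \min (cst 0 \max (fun x => M + 1 - `|x|)))//.
apply: (@min_fun_continuous _ R R); first by move=> x; exact: cvg_cst.
apply: (@max_fun_continuous _ R R); first by move=> x; exact: cvg_cst.
by move=> x; apply: (@cvgB _ R^o); [exact: cvg_cst|exact: norm_continuous].
Qed.

Lemma trapezoid_supported M : supported (trapezoid M) (M + 1).
Proof.
move=> x Mx; rewrite /trapezoid (max_idPl _) ?subr_le0//.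
by rewrite (min_idPr _).
Qed.

Lemma trapezoid_itv M x : 0 <= trapezoid M x <= 1.
Proof. by rewrite /trapezoid le_min ler01 le_max lexx ge_min lexx. Qed.

Lemma trapezoid1 M x : `|x| <= M -> trapezoid M x = 1.
Proof.
move=> xM; rewrite /trapezoid (min_idPl _)// le_max; apply/orP; right; lra.
Qed.

Lemma trapezoid_bmeas M : bmeas (trapezoid M).
Proof. exact: supported_bmeas (@trapezoid_continuous M) (@trapezoid_supported M). Qed.

End compactly_supported.

(** * Empirical averages of real sequences *)

Section average.
Context {R : realType}.
Implicit Types (h k : nat -> R) (n : nat).

Definition avg n h : R := n%:R^-1 * \sum_(i < n) h i.

Lemma eq_avg n h k : (forall i, (i < n)%N -> h i = k i) -> avg n h = avg n k.
Proof. by move=> hk; congr (_ * _); apply: eq_bigr => i _; exact: hk. Qed.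

Lemma avgD n h k : avg n (fun i => h i + k i) = avg n h + avg n k.
Proof. by rewrite /avg big_split mulrDr. Qed.

Lemma avgZ n (c : R) h : avg n (fun i => c * h i) = c * avg n h.
Proof. by rewrite /avg -mulr_sumr mulrCA. Qed.

Lemma avg_sum I (r : seq I) n (h : I -> nat -> R) :
  avg n (fun i => \sum_(j <- r) h j i) = \sum_(j <- r) avg n (h j).
Proof. by rewrite /avg exchange_big/= mulr_sumr. Qed.

Lemma avg_cst n (c : R) : (0 < n)%N -> avg n (fun=> c) = c.
Proof.
move=> n0; rewrite /avg sumr_const card_ord -[c *+ n]mulr_natl mulKf//.
by rewrite pnatr_eq0 -lt0n.
Qed.

Lemma avg_le n h k : (forall i, (i < n)%N -> h i <= k i) -> avg n h <= avg n k.
Proof. by move=> hk; rewrite ler_wpM2l ?invr_ge0// ler_sum// => i _; exact: hk. Qed.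

Lemma avg_norm n h : `|avg n h| <= avg n (fun i => `|h i|).
Proof.
rewrite normrM ger0_norm ?invr_ge0//.
by rewrite ler_wpM2l ?invr_ge0// ler_norm_sum.
Qed.

End average.

(** * The empirical-likelihood expansion at a fixed outcome *)

Section empirical_likelihood.
Context {R : realType}.

(** The inequality ln (1 + y) <= y at y = 1 / (1 + x) - 1 gives ln (1 + x) >= x / (1 + x) = x - x^2
    / (1 + x), and 1 / (1 + x) <= 2. *)
Lemma ln1D_ge (x : R) : `|x| <= 2^-1 -> x - 2 * x ^+ 2 <= ln (1 + x).
Proof.
rewrite ler_norml => /andP[x1 x2].
have x0 : 0 < 1 + x by lra.
have xi0 : 0 < (1 + x)^-1 by rewrite invr_gt0.
have /le_ln1Dx : -1 < (1 + x)^-1 - 1 by lra.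
rewrite addrCA subrr addr0 lnV ?posrE// => lnx.
have E : (1 + x) * (1 + x)^-1 = 1 by rewrite mulfV// gt_eqF.
nra.
Qed.

(* Along [s |-> a + s u] each logarithm is [ln a + ln (1 + s v)] with
   [v = u / a]; were [\sum v] nonzero, a small step in its direction would
   increase the sum. *)
Lemma sum_ln_max_foc n (a u : nat -> R) : (forall i, (i < n)%N -> 0 < a i) ->
  (forall s, (forall i, (i < n)%N -> 0 < a i + s * u i) ->
     \sum_(i < n) ln (a i + s * u i) <= \sum_(i < n) ln (a i)) ->
  \sum_(i < n) u i / a i = 0.
Proof.
move=> a0 amax; pose v i := u i / a i.
rewrite -/(\sum_(i < n) v i); set S := \sum_(i < n) v i.
apply/eqP/negPn/negP => S0.
pose W := \sum_(i < n) v i ^+ 2; pose B := 1 + \sum_(i < n) `|v i|.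
have W0 : 0 <= W by apply: sumr_ge0 => i _; exact: sqr_ge0.
have B1 : 1 <= B by rewrite lerDl; apply: sumr_ge0.
have vB i : (i < n)%N -> `|v i| <= B.
  move=> ni; rewrite /B (bigD1 (Ordinal ni))//= addrCA lerDl addr_ge0//.
  exact: sumr_ge0.
(* The step taken is s = del S. The second summand gives |s v i| <= 1/2, as [ln1D_ge] requires; with
   the first, 2 W del < 1, so the quadratic loss stays below the gain del S^2. *)
pose del : R := (2 * W + 2 * B * (`|S| + 1))^-1.
have S1 := normr_ge0 S.
have den0 : 0 < 2 * W + 2 * B * (`|S| + 1) by nra.
have del0 : 0 < del by rewrite invr_gt0.
have delE : del * (2 * W + 2 * B * (`|S| + 1)) = 1 by rewrite mulVf// gt_eqF.
have sv i : (i < n)%N -> `|del * S * v i| <= 2^-1.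
  move=> /vB vi; rewrite normrM [`|del * S|]normrM (gtr0_norm del0).
  have Sv : `|S| * `|v i| <= B * (`|S| + 1).
    by have := ler_wpM2l S1 vi; lra.
  rewrite -mulrA; apply: (le_trans (ler_wpM2l (ltW del0) Sv)).
  by have := mulr_ge0 (ltW del0) W0; move: delE; rewrite mulrDr -!(mulrA 2) !(mulrCA del); lra.
have aE i : (i < n)%N -> a i + del * S * u i = a i * (1 + del * S * v i).
  by move=> /a0 ai; rewrite /v; field; rewrite gt_eqF.
have sv0 i : (i < n)%N -> 0 < 1 + del * S * v i.
  by move=> /sv; rewrite ler_norml => /andP[]; lra.
have pos i : (i < n)%N -> 0 < a i + del * S * u i.
  by move=> ni; rewrite aE// mulr_gt0 ?a0// sv0.
have := amax _ pos; rewrite -subr_le0 -sumrB => H.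
have : \sum_(i < n) (del * S * v i - 2 * (del * S * v i) ^+ 2) <= 0.
  apply: le_trans H; apply: ler_sum => i _; have ni := ltn_ord i.
  rewrite aE// lnM ?posrE ?a0 ?sv0// addrAC subrr add0r.
  by apply: ln1D_ge; exact: sv.
rewrite sumrB -mulr_sumr -/S.
under [X in _ - X]eq_bigr do rewrite exprMn mulrA.
rewrite -mulr_sumr -/W.
have S2 : 0 < S ^+ 2 by rewrite exprn_even_gt0.
have -> : del * S * S - 2 * (del * S) ^+ 2 * W = del * (S ^+ 2 * (1 - del * (2 * W))) by ring.
rewrite pmulr_rle0// pmulr_rle0// => ?; nra.
Qed.

(** The bound N <= C1 (Del + (K + 1) N Del) on N = |eta| has [N] on both sides; Del <= [del0] makes
    its coefficient on the right at most 1/2, so it can be absorbed. *)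
Lemma el_expansion m (G : 'M[R]_m.+1) (p b : 'I_m.+1 -> R) (K : R) :
  0 <= K -> G \in unitmx -> (forall k l, G k l = G l k) ->
  (forall l, \sum_k G l k * b k = p l) ->
  exists C del0 : R, [/\ 0 <= C, 0 < del0 &
  forall n (g : nat -> 'I_m.+1 -> R) (q : nat -> R) (eta : 'I_m.+1 -> R) (Del : R),
    let a i := 1 + \sum_k eta k * g i k in
    (0 < n)%N -> (forall i k, `|g i k| <= K) -> (forall i, `|q i| <= K) ->
    (forall i, (i < n)%N -> 0 < a i) ->
    (forall k, \sum_(i < n) g i k / a i = 0) ->
    (forall k, `|avg n (fun i => g i k)| <= Del) ->
    (forall k l, `|avg n (fun i => g i k * g i l) - G k l| <= Del) ->
    (forall k, `|avg n (fun i => q i * g i k) - p k| <= Del) ->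
    Del <= del0 ->
    avg n (fun i => (a i)^-1) = 1 /\
    `|avg n (fun i => q i / a i)
      - (avg n q - \sum_k b k * avg n (fun i => g i k))| <= C * Del ^+ 2].
Proof.
move=> K0 Gu Gs Gb.
pose C1 : R := \sum_k \sum_l `|invmx G k l|.
have C10 : 0 <= C1 by apply: sumr_ge0 => k _; apply: sumr_ge0.
pose Bs : R := \sum_k `|b k|.
have Bs0 : 0 <= Bs by apply: sumr_ge0.
(* The final error is (1 + K) (1 + Bs) N Del, combined with N <= 2 C1 Del. The + 1 in [del0] covers
   C1 = 0. *)
exists (2 * C1 * (1 + K) * (1 + Bs)), (2 * C1 * (K + 1) + 1)^-1; split.
- by rewrite !mulr_ge0//; lra.
- by rewrite invr_gt0; nra.
move=> n g q eta Del a n0 gK qK a0 foc gD GD pD Ddel0.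
have Del0 : 0 <= Del by exact: le_trans (gD ord0).
pose y i := \sum_k eta k * g i k.
pose N := \sum_k `|eta k|.
have N0 : 0 <= N by apply: sumr_ge0.
have aV i : (i < n)%N -> (a i)^-1 = 1 - y i / a i.
  by move=> /a0 ai; rewrite /a -/(y i) in ai *; field; rewrite gt_eqF.
have yE (h : nat -> R) : avg n (fun i => h i * y i) = \sum_k eta k * avg n (fun i => h i * g i k).
  under eq_bigr do rewrite -avgZ.
  rewrite -avg_sum; apply: eq_avg => i _; rewrite /y mulr_sumr; apply: eq_bigr => k _.
  by rewrite mulrCA.
have foc' k : avg n (fun i => g i k / a i) = 0 by rewrite /avg foc mulr0.
have ya0 : avg n (fun i => y i / a i) = 0.
  under eq_fun do rewrite mulrC.
  rewrite yE big1// => k _; rewrite (_ : avg _ _ = 0) ?mulr0// -(foc' k).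
  by apply: eq_avg => i _; rewrite mulrC.
pose T := avg n (fun i => y i ^+ 2 / a i).
have expand (h : nat -> R) : avg n (fun i => h i / a i) =
    avg n h - avg n (fun i => h i * y i) + avg n (fun i => h i * (y i ^+ 2 / a i)).
  rewrite -mulN1r -avgZ -!avgD; apply: eq_avg => i /a0 ai.
  by rewrite /a -/(y i) in ai *; field; rewrite gt_eqF.
have yya i : (i < n)%N -> 0 <= y i ^+ 2 / a i.
  by move=> /a0 ai; rewrite mulr_ge0 ?sqr_ge0// invr_ge0 ltW.
have rem (h : nat -> R) : (forall i, `|h i| <= K) ->
    `|avg n (fun i => h i * (y i ^+ 2 / a i))| <= K * T.
  move=> hK; rewrite (le_trans (avg_norm _ _))// /T -avgZ; apply: avg_le => i ni.
  by rewrite normrM (ger0_norm (yya i ni)) ler_wpM2r// yya.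
have TE : T = \sum_k eta k * avg n (fun i => g i k).
  have -> : T = avg n (fun i => 1 * y i).
    have -> : avg n (fun i => 1 * y i) = avg n (fun i => y i / a i + y i ^+ 2 / a i).
      apply: eq_avg => i /a0 ai.
      by rewrite /a -/(y i) in ai *; field; rewrite gt_eqF.
    by rewrite avgD ya0 add0r.
  by rewrite yE; apply: eq_bigr => k _; congr (_ * _); apply: eq_avg => i _; rewrite mul1r.
have dotN (z : 'I_m.+1 -> R) (e : R) : (forall k, `|z k| <= e) ->
    `|\sum_k eta k * z k| <= N * e.
  move=> ze; rewrite (le_trans (ler_norm_sum _ _ _))// /N mulr_suml ler_sum// => k _.
  by rewrite normrM ler_wpM2l.
have dotB (z : 'I_m.+1 -> R) (e : R) : (forall k, `|z k| <= e) ->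
    `|\sum_k b k * z k| <= Bs * e.
  move=> ze; rewrite (le_trans (ler_norm_sum _ _ _))// /Bs mulr_suml ler_sum// => k _.
  by rewrite normrM ler_wpM2l.
have TN : T <= N * Del by rewrite (le_trans (ler_norm _))// TE dotN.
pose rho k := avg n (fun i => g i k * (y i ^+ 2 / a i)).
have rhoK k : `|rho k| <= K * (N * Del).
  by rewrite (le_trans (rem (fun i => g i k) (fun i => gK i k)))// ler_wpM2l.
pose Gh k l := avg n (fun i => g i k * g i l).
have GhE k : \sum_l eta l * Gh k l = avg n (fun i => g i k) + rho k.
  have := expand (fun i => g i k); rewrite foc' yE -/(rho k) => H.
  by apply/eqP; rewrite -subr_eq0; apply/eqP; rewrite /Gh; lra.
have GhG k : `|\sum_l eta l * (Gh k l - G k l)| <= N * Del.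
  by apply: dotN => l; exact: GD.
have Geta k : `|\sum_l eta l * G k l| <= Del + K * (N * Del) + N * Del.
  have -> : \sum_l eta l * G k l =
      avg n (fun i => g i k) + rho k - \sum_l eta l * (Gh k l - G k l).
    by rewrite -GhE -sumrB; apply: eq_bigr => l _; ring.
  by rewrite (le_trans (ler_normB _ _))// lerD// (le_trans (ler_normD _ _))// lerD.
have NC : N <= C1 * (Del + K * (N * Del) + N * Del).
  rewrite /C1 mulr_suml ler_sum// => k _.
  (* Writing eta as G^-1 (G eta) lets the bound [Geta] apply entrywise. *)
  have -> : eta k = \sum_l invmx G k l * \sum_j eta j * G l j.
    have := congr1 (fun M : 'cV[R]_m.+1 => M k 0) (mulKmx Gu (\col_j eta j)).
    rewrite mxE => H; rewrite mxE in H; rewrite -H; apply: eq_bigr => l _.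
    congr (_ * _); rewrite mxE; apply: eq_bigr => j _.
    by rewrite mxE mulrC.
  rewrite (le_trans (ler_norm_sum _ _ _))// mulr_suml ler_sum// => l _.
  by rewrite normrM ler_wpM2l.
have N2 : N <= 2 * C1 * Del.
  have CK : 0 <= C1 * (K + 1) by rewrite mulr_ge0//; lra.
  have z2 : 2 * (C1 * (K + 1) * Del) <= 1.
    apply: le_trans (_ : 2 * (C1 * (K + 1) * (2 * C1 * (K + 1) + 1)^-1) <= 1).
      by rewrite ler_wpM2l// ler_wpM2l.
    rewrite -(mulrA 2); move: (C1 * (K + 1)) CK => z z0.
    by rewrite mulrA ler_pdivrMr ?mul1r ?lerDl// ltr_wpDl// mulr_ge0.
  move: NC z2; have -> : C1 * (Del + K * (N * Del) + N * Del) = C1 * Del + C1 * (K + 1) * Del * N by ring.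
  rewrite -(mulrA 2); move: (C1 * (K + 1) * Del) (C1 * Del) => z w NC z2.
  by have := ler_wpM2r N0 z2; lra.
split.
  have -> : avg n (fun i => (a i)^-1) = avg n (fun i => 1 + (-1) * (y i / a i)).
    by apply: eq_avg => i ni; rewrite [LHS]aV// mulN1r.
  by rewrite avgD avgZ ya0 mulr0 addr0 avg_cst.
rewrite expand yE.
set r' := avg n (fun i => q i * _).
have r'K : `|r'| <= K * (N * Del) by rewrite (le_trans (rem q qK))// ler_wpM2l.
pose ph k := avg n (fun i => q i * g i k).
(* Both sides are eta^T G b, by G b = p and symmetry. This trades eta.p for b.(G eta), which the
   first-order condition matches with b.E_n g up to remainders. *)
have key : \sum_k eta k * p k = \sum_k b k * \sum_l eta l * G k l.
  under eq_bigr do rewrite -Gb mulr_sumr.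
  rewrite exchange_big/=; apply: eq_bigr => k _; rewrite mulr_sumr.
  by apply: eq_bigr => l _; rewrite (Gs k l); ring.
have -> : avg n q - \sum_k eta k * avg n (fun i => q i * g i k) + r'
    - (avg n q - \sum_k b k * avg n (fun i => g i k)) =
    \sum_k b k * (\sum_l eta l * (Gh k l - G k l)) - \sum_k b k * rho k
    - \sum_k eta k * (ph k - p k) + r'.
  have -> : \sum_k eta k * (ph k - p k) = \sum_k eta k * ph k - \sum_k eta k * p k.
    by rewrite -sumrB; apply: eq_bigr => k _; ring.
  have -> : \sum_k b k * (\sum_l eta l * (Gh k l - G k l)) =
      \sum_k b k * avg n (fun i => g i k) + \sum_k b k * rho k
      - \sum_k b k * (\sum_l eta l * G k l).
    rewrite -big_split/= -sumrB; apply: eq_bigr => k _.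
    have -> : \sum_l eta l * (Gh k l - G k l) = \sum_l eta l * Gh k l - \sum_l eta l * G k l.
      by rewrite -sumrB; apply: eq_bigr => l _; ring.
    by rewrite GhE; ring.
  by rewrite key /ph; ring.
have := dotB _ _ GhG; have := dotB _ _ rhoK; have := dotN _ _ pD.
rewrite -/(ph) => H1 H2 H3.
apply: (@le_trans _ _ ((1 + K) * (1 + Bs) * (N * Del))); last first.
  have -> : 2 * C1 * (1 + K) * (1 + Bs) * Del ^+ 2 = (1 + K) * (1 + Bs) * (2 * C1 * Del * Del).
    by ring.
  by rewrite ler_wpM2l ?mulr_ge0//; [lra|lra|rewrite ler_wpM2r].
rewrite (le_trans (ler_normD _ _))//.
have := ler_normB (\sum_k b k * (\sum_l eta l * (Gh k l - G k l)) - \sum_k b k * rho k)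
   (\sum_k eta k * (ph k - p k)).
have := ler_normB (\sum_k b k * (\sum_l eta l * (Gh k l - G k l))) (\sum_k b k * rho k).
move=> H4 H5; move: r'K H1 H2 H3; rewrite /ph /=; nra.
Qed.

End empirical_likelihood.

(** * Stein's identity for normalized sums, in the limit *)

Section stein_identity.
Context {R : realType} {dO : measure_display} {Om : measurableType dO}.
Variable P : probability Om R.

Lemma mvt_increment (phi psi : R -> R) : (forall x : R, is_derive x 1 phi (psi x)) ->
  forall x h : R, exists2 xi, `|xi - x| <= `|h| & phi (x + h) - phi x = psi xi * h.
Proof.
move=> dphi x h.
have cphi : continuous phi.
  move=> y; apply: differentiable_continuous; apply/derivable1_diffP.
  by have [] := dphi y.
have [h0|h0] := leP 0 h.
  have xh : x <= x + h by rewrite lerDl.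
  have [xi] := @MVT_segment R phi psi _ _ xh (fun y _ => dphi y) (continuous_subspaceT cphi).
  rewrite in_itv/= => /andP[x1 x2] E; exists xi; last by rewrite E; congr (_ * _); ring.
  by rewrite !ger0_norm ?subr_ge0// lerBlDl.
have xh : x + h <= x by rewrite gerDl ltW.
have [xi] := @MVT_segment R phi psi _ _ xh (fun y _ => dphi y) (continuous_subspaceT cphi).
rewrite in_itv/= => /andP[x1 x2] E; exists xi.
  by rewrite (ltr0_norm h0) ler0_norm ?subr_le0//; lra.
by apply: (@oppr_inj R); rewrite opprB E; ring.
Qed.

Variable U : nat -> Om -> R.
Hypotheses (iidU : iid_bounded P U) (EU : Ex P (U 0%N) = 0).

Definition nsum (n : nat) (w : Om) : R := (Num.sqrt n%:R)^-1 * \sum_(i < n) U i w.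

Lemma nsum_bmeas n : bmeas (nsum n).
Proof. by apply: bmeasZ; apply: bmeas_sum => i; exact: iidb_bmeas iidU i. Qed.

Let s2 := Ex P (fun w => U 0%N w ^+ 2).

Lemma Ex_nsum_sqr n : (0 < n)%N -> Ex P (fun w => nsum n w ^+ 2) = s2.
Proof.
move=> n0; have nR : n%:R != 0 :> R by rewrite pnatr_eq0 -lt0n.
have nR0 : 0 <= n%:R :> R by [].
have E w : nsum n w ^+ 2 = n%:R * (n%:R^-1 * \sum_(i < n) U i w) ^+ 2.
  have -> : n%:R * (n%:R^-1 * \sum_(i < n) U i w) ^+ 2 =
      n%:R * n%:R^-1 * n%:R^-1 * (\sum_(i < n) U i w) ^+ 2 by ring.
  by rewrite mulfV// mul1r /nsum exprMn exprVn sqr_sqrtr.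
under eq_fun do rewrite E.
rewrite ExZ; last first.
  by apply: bmeasX; apply: bmeasZ; apply: bmeas_sum => i; exact: iidb_bmeas iidU i.
by rewrite (Ex_mean_sqr iidU)// mulrA mulfV// mul1r.
Qed.

(* Remove the [i]-th summand from [nsum n]; the rest is independent of [U i], so
   a first-order Taylor expansion gives [E (U_i phi) = s2 E psi / sqrt n + o(1 / sqrt n)]. *)
Lemma stein_limit (phi psi : R -> R) : (forall x : R, is_derive x 1 phi (psi x)) ->
  bmeas phi -> bmeas psi -> unif_cont psi ->
  Ex P (fun w => s2 * psi (nsum n w) - nsum n w * phi (nsum n w)) @[n --> \oo] --> (0 : R).
Proof.
move=> dphi bphi bpsi uc; have [M UM] := iidb_bound iidU.
have M0 : 0 <= M by exact: le_trans (UM 0%N point).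
have s20 : 0 <= s2 by apply: Ex_ge0 => w; exact: sqr_ge0.
have bU i : bmeas (U i) by exact: iidb_bmeas iidU i.
have bS n : bmeas (nsum n) by exact: nsum_bmeas.
have bcomp (h : R -> R) (f : Om -> R) : bmeas h -> bmeas f -> bmeas (fun w => h (f w)).
  by move=> bh [mf _]; exact: bmeas_comp bh mf.
apply/cvgrPdist_le => e e0.
(* [M ^+ 2] pays for the Taylor remainder and [s2] for restoring the removed summand inside [psi];
   the + 1 makes [K] positive. *)
pose K := M ^+ 2 + s2 + 1; have K0 : 0 < K by have := sqr_ge0 M; rewrite /K; lra.
pose e' := e / K; have e'0 : 0 < e' by exact: divr_gt0.
have [del del0 ucd] := uc e' e'0.
near=> n.
have n0 : (0 < n)%N by near: n; exists 1%N.
pose c : R := (Num.sqrt n%:R)^-1.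
have sn0 : 0 < Num.sqrt n%:R :> R by rewrite sqrtr_gt0 ltr0n.
have c0 : 0 < c by rewrite invr_gt0.
have cn : c * (n%:R * c) = 1.
  by rewrite /c mulrCA -expr2 exprVn sqr_sqrtr// mulfV// pnatr_eq0 -lt0n.
(* One summand moves the normalized sum by less than [del], so the uniform continuity of [psi]
   applies to each removal. *)
have cM : c * M < del.
  rewrite mulrC ltr_pdivrMr// mulrC -ltr_pdivrMr//.
  have Md0 : 0 <= M / del by rewrite divr_ge0// ltW.
  rewrite -[X in X < _](ger0_norm Md0) -sqrtr_sqr ltr_sqrt ?ltr0n//.
  by near: n; exact: nbhs_infty_gtr.
rewrite sub0r normrN.
pose r i := [seq j <- iota 0 n | j != i].
pose Si i w := c * \sum_(j <- r i) U j w.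
have SE i w : (i < n)%N -> nsum n w = Si i w + c * U i w.
  move=> ni; rewrite /nsum /Si -mulrDr; congr (_ * _).
  rewrite -(big_mkord xpredT (fun i => U i w)) /index_iota subn0.
  by rewrite (bigD1_seq i) ?mem_iota ?iota_uniq//= /r big_filter addrC.
have bSi i : bmeas (Si i) by apply: bmeasZ; exact: bmeas_sum.
pose a := Ex P (fun w => psi (nsum n w)).
have step i : (i < n)%N ->
    `|Ex P (fun w => U i w * phi (nsum n w)) - c * (s2 * a)| <= c * ((M ^+ 2 + s2) * e').
  move=> ni.
  have ur : uniq (r i) by rewrite filter_uniq// iota_uniq.
  have ir : i \notin r i by rewrite mem_filter eqxx.
  pose rem w := U i w * phi (nsum n w) - U i w * phi (Si i w) - c * (U i w ^+ 2 * psi (Si i w)).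
  have b1 : bmeas (fun w => U i w * phi (nsum n w)) by apply: bmeasM => //; exact: bcomp.
  have b2 : bmeas (fun w => U i w * phi (Si i w)) by apply: bmeasM => //; exact: bcomp.
  have b3 : bmeas (fun w => U i w ^+ 2 * psi (Si i w)).
    by apply: bmeasM; [exact: bmeasX|exact: bcomp].
  have b3c : bmeas (fun w => c * (U i w ^+ 2 * psi (Si i w))) by exact: bmeasZ.
  have brem : bmeas rem by apply: bmeasB => //; exact: bmeasB.
  have U2M j w : `|U j w ^+ 2| <= M ^+ 2.
    by rewrite normrX lerXn2r ?nnegrE.
  have remB w : `|rem w| <= c * (M ^+ 2 * e').
    rewrite /rem (SE i w ni).
    have [xi xiS E] := mvt_increment dphi (Si i w) (c * U i w).
    have -> : U i w * phi (Si i w + c * U i w) - U i w * phi (Si i w)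
      - c * (U i w ^+ 2 * psi (Si i w)) = c * (U i w ^+ 2 * (psi xi - psi (Si i w))).
      by rewrite -mulrBr E; ring.
    rewrite normrM gtr0_norm// ler_wpM2l ?(ltW c0)// normrM ler_pM//.
    apply: ucd; apply: le_lt_trans xiS (le_lt_trans _ cM).
    by rewrite normrM gtr0_norm// ler_wpM2l// ltW.
  have Erem := Ex_bound P brem remB.
  have E1 : Ex P (fun w => U i w * phi (Si i w)) = 0.
    rewrite (Ex_indep_sum iidU (F := id) c ur ir _ _ bphi)//; last by exists M.
    by rewrite (Ex_iid iidU i (F := id)) ?EU ?mul0r//; exists M.
  have E2 : Ex P (fun w => U i w ^+ 2 * psi (Si i w)) = s2 * Ex P (fun w => psi (Si i w)).
    have mX : measurable_fun [set: R] (fun u : R => u ^+ 2) by exact: measurable_funX.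
    rewrite (Ex_indep_sum iidU c ur ir mX _ bpsi); last by exists (M ^+ 2).
    by rewrite (Ex_iid iidU i mX)//; exists (M ^+ 2).
  have E3 : `|Ex P (fun w => psi (Si i w)) - a| <= e'.
    rewrite /a -ExB; [|exact: bcomp..].
    apply: Ex_bound => [|w]; first by apply: bmeasB; exact: bcomp.
    apply: ucd; rewrite (SE i w ni) opprD addNKr normrN normrM gtr0_norm//.
    by apply: le_lt_trans cM; rewrite ler_wpM2l// ltW.
  have E4 : Ex P rem = Ex P (fun w => U i w * phi (nsum n w))
      - c * (s2 * Ex P (fun w => psi (Si i w))).
    by rewrite /rem ExB// ?ExB// ?ExZ// ?E1 ?E2 ?subr0//; exact: bmeasB.
  have -> : Ex P (fun w => U i w * phi (nsum n w)) - c * (s2 * a) =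
      Ex P rem + c * (s2 * (Ex P (fun w => psi (Si i w)) - a)) by rewrite E4; ring.
  rewrite (le_trans (ler_normD _ _))// mulrDl mulrDr lerD//.
  rewrite normrM gtr0_norm// ler_wpM2l ?(ltW c0)// normrM ger0_norm//.
  by rewrite ler_wpM2l.
have b1 i : bmeas (fun w => U i w * phi (nsum n w)) by apply: bmeasM => //; exact: bcomp.
(* Since n c^2 = 1, the term s2 E psi splits into n equal shares, one subtracted from each summand
   of E (S phi(S)). *)
have -> : Ex P (fun w => s2 * psi (nsum n w) - nsum n w * phi (nsum n w)) =
    - (c * \sum_(i < n) (Ex P (fun w => U i w * phi (nsum n w)) - c * (s2 * a))).
  rewrite ExB; [|by apply: bmeasZ; exact: bcomp|by apply: bmeasM => //; exact: bcomp].
  rewrite ExZ; last exact: bcomp.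
  have -> : Ex P (fun w => nsum n w * phi (nsum n w)) =
      c * \sum_(i < n) Ex P (fun w => U i w * phi (nsum n w)).
    rewrite -Ex_sum// -ExZ; last exact: bmeas_sum.
    congr Ex; apply/funext => w; rewrite {1}/nsum -/c -mulrA; congr (_ * _).
    by rewrite mulr_suml.
  rewrite sumrB sumr_const card_ord -[_ *+ n]mulr_natl mulrBr.
  have -> : c * (n%:R * (c * (s2 * a))) = c * (n%:R * c) * (s2 * a) by ring.
  by rewrite cn mul1r -/a opprB.
rewrite normrN normrM gtr0_norm//.
apply: (@le_trans _ _ (c * \sum_(i < n) c * ((M ^+ 2 + s2) * e'))).
  rewrite ler_wpM2l ?(ltW c0)// (le_trans (ler_norm_sum _ _ _))// ler_sum// => i _.
  exact: step.
rewrite sumr_const card_ord -[_ *+ n]mulr_natl.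
have -> : c * (n%:R * (c * ((M ^+ 2 + s2) * e'))) = c * (n%:R * c) * ((M ^+ 2 + s2) * e') by ring.
rewrite cn mul1r; apply: (@le_trans _ _ (e' * K)); last by rewrite divfK// gt_eqF.
by rewrite mulrC ler_wpM2l ?(ltW e'0)// lerDl.
Unshelve. all: by end_near. Qed.

End stein_identity.

(** * Gaussian expectations and Stein's equation *)

Section normal_expectation.
Context {R : realType}.
Notation mu := (@lebesgue_measure R).
Variable sg : R.
Hypothesis sg0 : 0 < sg.
Let pdf := normal_pdf 0 sg.
Let N : probability (measurableTypeR R) R := normal_prob 0 sg.

Lemma integrable_mul_normal_pdf (f : R -> R) : bmeas f ->
  mu.-integrable setT (EFin \o (fun x => f x * pdf x)).
Proof.
move=> [mf [M fM]].
have iM : mu.-integrable setT (fun x => (M%:E * (pdf x)%:E)%E).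
  by apply: integrableZl => //; exact: integrable_normal_pdf.
apply: le_integrable iM => //.
  apply/measurable_EFinP; apply: measurable_funM => //.
  exact: measurable_normal_pdf.
move=> x _ /=; rewrite lee_fin !normrM ler_wpM2r//.
by rewrite (le_trans (fM x))// ler_norm.
Qed.

(** On indicators this is the definition of [normal_prob] by its density; both sides are bounded
    functionals, the right one because the density has integral one. *)
Lemma Ex_normal (f : R -> R) : bmeas f ->
  Ex N f = (\int[mu]_x (f x * pdf x))%R.
Proof.
move=> bf.
apply: (bfunctional_eq (L1 := Ex N) (L2 := fun f => (\int[mu]_x (f x * pdf x))%R) _ _ _ bf).
- split=> [f1 f2|c f1|].
  + exact: ExD.
  + exact: ExZ.
  + by exists 1 => // f1 e bf1 fe; rewrite mul1r; exact: Ex_bound.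
- split=> [f1 f2 b1 b2|c f1 b1|].
  + rewrite -RintegralD//; [|exact: integrable_mul_normal_pdf..].
    by apply: eq_Rintegral => x _; rewrite mulrDl.
  + rewrite -RintegralZl//; last exact: integrable_mul_normal_pdf.
    by apply: eq_Rintegral => x _; rewrite mulrA.
  + exists 1 => // f1 e b1 fe.
    rewrite (le_trans (le_normr_Rintegral _ _))//.
      exact: integrable_mul_normal_pdf.
    have -> : 1 * e = (\int[mu]_x (e * pdf x))%R.
      rewrite RintegralZl//; last exact: integrable_normal_pdf.
      by rewrite mul1r /Rintegral integral_normal_pdf/= mulr1.
    apply: le_Rintegral => //.
    * have /integrable_mul_normal_pdf := bmeas_norm b1.
      congr (_.-integrable _ _); apply/funext => x /=; congr EFin.
      by rewrite normrM (ger0_norm (normal_pdf_ge0 _ _ _)).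
    * exact: (integrable_mul_normal_pdf (bmeas_cst e)).
    * move=> x _; rewrite normrM (ger0_norm (normal_pdf_ge0 _ _ _)).
      by rewrite ler_wpM2r ?normal_pdf_ge0.
- move=> B mB; rewrite Ex_indic// /Pr /N /normal_prob /=.
  rewrite -[LHS]/(\int[mu]_(x in B) pdf x)%R Rintegral_mkcond.
  apply: eq_Rintegral => x _; rewrite patchE indicE.
  by case: (x \in B); rewrite ?mul1r ?mul0r.
Qed.

Lemma normal_tight (e : R) : 0 < e -> exists M0 : R, forall M, M0 <= M ->
  1 - e <= Ex N (trapezoid M).
Proof.
move=> e0.
pose F (n : nat) : set (measurableTypeR R) := `[- n%:R, n%:R]%classic.
have mF n : measurable (F n) by exact: measurable_itv.
have FT : \bigcup_n F n = setT.
  apply/seteqP; split=> // x _; exists (Num.truncn `|x|).+1 => //.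
  by rewrite /F /= in_itv/= -ler_norml ltW// truncnS_gt.
have NT : N setT = 1%E by exact: probability_setT.
have cN : (N \o F) n @[n --> \oo] --> 1%E.
  rewrite -NT -FT; apply: nondecreasing_cvg_mu => //; first by rewrite FT.
  move=> n m nm; apply/subsetPset => x; rewrite /F /= !in_itv/= -!ler_norml => xn.
  by rewrite (le_trans xn)// ler_nat.
move: cN => /fine_cvgP[_] /= /cvgrPdist_le/(_ _ e0)[n /= _ /(_ n (leqnn _))].
move=> /= H; exists n%:R => M nM.
have : Pr N (F n) <= Ex N (trapezoid M).
  rewrite -Ex_indic//; apply: Ex_le => [||x]; [exact: bmeas_indic|exact: trapezoid_bmeas|].
  rewrite indicE; case: (boolP (x \in F n)) => [/set_mem|_]; last by case/andP: (trapezoid_itv M x).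
  by rewrite /F /= in_itv/= -ler_norml => xn; rewrite trapezoid1// (le_trans xn).
by move: H; rewrite ler_norml /Pr => /andP[_]; lra.
Qed.

Lemma is_derive_normal_pdf_inv (x : R) :
  is_derive x 1 (fun y : R => expR (y ^+ 2 / (2 * sg ^+ 2)))
    (expR (x ^+ 2 / (2 * sg ^+ 2)) * (x / sg ^+ 2)).
Proof.
have d1 : is_derive x 1 (fun y : R => y ^+ 2 / (2 * sg ^+ 2)) (x / sg ^+ 2).
  have -> : (fun y : R => y ^+ 2 / (2 * sg ^+ 2)) = (2 * sg ^+ 2)^-1 \*: (fun y : R => y ^+ 2).
    by apply/funext => y /=; rewrite mulrC.
  apply: is_derive_eq; rewrite /= !scaler1 -mulr_natl /GRing.scale/=; field.
  by rewrite gt_eqF.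
exact: is_derive1_comp.
Qed.

(* The solution [phi] of Stein's equation is [int_{-oo}^x D pdf / (sg^2 pdf x)];
   it vanishes for large [x] because [D] has Gaussian mean zero. *)
Lemma stein_solution (D : R -> R) (M : R) : continuous D -> supported D M ->
  Ex N D = 0 ->
  exists phi psi : R -> R, [/\ forall x : R, is_derive x 1 phi (psi x),
    continuous psi, supported phi M, supported psi M &
    forall x, sg ^+ 2 * psi x - x * phi x = D x].
Proof.
move=> cD DM ED; have bD := supported_bmeas cD DM.
have sgN : sg != 0 by rewrite gt_eqF.
pose h x := D x * pdf x.
have ih : mu.-integrable setT (EFin \o h) by exact: integrable_mul_normal_pdf.
have ch : continuous h.
  by move=> x; apply: cvgM; [exact: cD|exact: continuous_normal_pdf].
pose I x := (\int[mu]_(y in `]-oo, x]) h y)%R.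
have dI (x : R) : is_derive x 1 I (h x).
  have xx1 : x < x + 1 by rewrite ltrDl.
  have ih1 : mu.-integrable [set` Interval -oo%O (BRight (x + 1))] (EFin \o h).
    by apply: integrableS ih => //; exact: measurable_itv.
  have xoo : (-oo%O < BRight x)%E by rewrite ltNyr.
  have [I1 I2] := continuous_FTC1 xx1 ih1 xoo (ch x).
  have I3 : 'D_1 I x = h x by rewrite -derive1E -I2.
  exact: (DeriveDef I1 I3).
have hM : supported h M by move=> x xM; rewrite /h DM// mul0r.
(* To the right of [M] the integral is already the full Gaussian mean, which is zero; to the left of
   -M its integrand vanishes. *)
have IM : supported I M.
  move=> x; have [x0|x0] := leP 0 x.
    rewrite ger0_norm// => Mx; rewrite /I Rintegral_mkcond -ED (Ex_normal bD).
    apply: eq_Rintegral => y _; rewrite patchE; case: ifPn => // /negP yx.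
    rewrite -/(h y) hM//.
    have xy : x < y by rewrite ltNge; apply/negP => yx'; apply: yx; rewrite inE/= in_itv.
    by rewrite (le_trans Mx)// (le_trans (ltW xy))// ler_norm.
  rewrite ltr0_norm// => Mx; rewrite /I -[RHS](Rintegral_set0 mu h).
  rewrite [LHS]Rintegral_mkcond [RHS]Rintegral_mkcond; apply: eq_Rintegral => y _.
  rewrite !patchE; case: ifPn; case: ifPn => //; rewrite ?in_set0// => _.
  rewrite inE/= in_itv/= => yx; rewrite hM// ler0_norm; lra.
pose E (x : R) := expR (x ^+ 2 / (2 * sg ^+ 2)).
(* As pdf E = normal_peak, the factor k E is 1 / (sg^2 pdf). *)
pose k : R := (normal_peak sg * sg ^+ 2)^-1.
have peak0 : normal_peak sg != 0 by rewrite gt_eqF// normal_peak_gt0.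
have pE x : pdf x * E x = normal_peak sg.
  rewrite /pdf normal_pdfE// /normal_fun -mulrA /E -expRD subr0.
  by rewrite mulNr mulr_natl addNr expR0 mulr1.
pose phi x := k * (I x * E x).
(* [psi] is read off from Stein's equation, so its continuity and support follow from those of [D]
   and [phi]; what needs proof is that it is the derivative of [phi]. *)
pose psi x := (D x + x * phi x) / sg ^+ 2.
have dphi (x : R) : is_derive x 1 phi (psi x).
  have dE := is_derive_normal_pdf_inv x.
  have -> : phi = k \*: (I * E) by [].
  apply: is_derive_eq; rewrite /psi /phi /GRing.scale/= -/(E x) /h.
  have kD : D x = k * sg ^+ 2 * (D x * (pdf x * E x)).
    by rewrite pE /k; field; rewrite sgN peak0.
  rewrite [X in _ = (X + _) / _]kD; field; exact: sgN.
have cphi : continuous phi.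
  move=> y; apply: differentiable_continuous; apply/derivable1_diffP.
  by have [] := dphi y.
exists phi, psi; split=> //.
- move=> x; apply: cvgM; last exact: cvg_cst.
  apply: (@cvgD _ R^o); first exact: cD.
  by apply: cvgM; [exact: cvg_id|exact: cphi].
- by move=> x xM; rewrite /phi IM// mul0r mulr0.
- by move=> x xM; rewrite /psi /phi IM// DM// mul0r !mulr0 addr0 mul0r.
- by move=> x; rewrite /psi mulrC divfK ?expf_neq0//; ring.
Qed.

End normal_expectation.

(** * The central limit theorem for bounded variables, with a negligible perturbation *)

Section central_limit.
Context {R : realType}.

(** The point mass for s2 = 0 and the normal law are presented as one tight probability [Q], so that
    the truncation argument is carried out once. *)
Lemma gauss_mean_Ex (s2 : R) : 0 <= s2 -> exists Q : probability (measurableTypeR R) R,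
  [/\ forall f : R -> R, bmeas f -> gauss_mean s2 f = Ex Q f &
      forall e : R, 0 < e -> exists M0 : R, forall M, M0 <= M -> 1 - e <= Ex Q (trapezoid M)].
Proof.
move=> s20; rewrite /gauss_mean; have [_|s2N] := eqVneq s2 0.
  pose d0 : probability (measurableTypeR R) R := @dirac _ (measurableTypeR R) (0 : R) R.
  have E0 (f : R -> R) : bmeas f -> Ex d0 f = f 0.
    move=> [mf _]; rewrite ExE /Rintegral integral_dirac//; last exact/measurable_EFinP.
    by rewrite diracT mul1e.
  exists d0; split=> [f /E0 ->//|e e0].
  exists 0 => M M0; rewrite E0; last exact: trapezoid_bmeas.
  by rewrite trapezoid1 ?normr0//; lra.
have sg0 : 0 < Num.sqrt s2 by rewrite sqrtr_gt0 lt_neqAle eq_sym s2N.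
exists (normal_prob 0 (Num.sqrt s2) : probability (measurableTypeR R) R); split.
  by move=> f bf; rewrite /Ex unlock.
exact: normal_tight.
Qed.

Context {dO : measure_display} {Om : measurableType dO}.
Variable P : probability Om R.

Let bcomp (h : R -> R) (f : Om -> R) :
  bmeas h -> measurable_fun setT f -> bmeas (fun w => h (f w)).
Proof. by move=> bh mf; exact: bmeas_comp bh mf. Qed.

(* [f] is replaced by [f chi - a chi], with [chi] a cutoff and [a] chosen to make
   the Gaussian mean zero; tightness controls the rest. *)
Lemma cvg_dist_normal_tight (s2 : R) (Y : nat -> Om -> R) : 0 <= s2 ->
  (forall n, measurable_fun [set: Om] (Y n)) ->
  (forall D M, continuous D -> supported D M -> gauss_mean s2 D = 0 ->
     Ex P (fun w => D (Y n w)) @[n --> \oo] --> (0 : R)) ->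
  (forall e : R, 0 < e -> exists M0 : R, forall M, M0 <= M ->
     \forall n \near \oo, 1 - e <= Ex P (fun w => trapezoid M (Y n w))) ->
  cvg_dist_normal P Y s2.
Proof.
move=> s20 mY cvgD0 tightY f cf [B0 fB0].
have [Q [gE tightQ]] := gauss_mean_Ex s20.
have bf : bmeas f by split; [exact: continuous_measurable_fun|exists B0].
rewrite gE//; pose B := `|B0| + 1.
have B1 : 1 <= B by rewrite lerDr.
have fB x : `|f x| <= B by rewrite (le_trans (fB0 x))// (le_trans (ler_norm _))// lerDl.
apply/cvgrPdist_le => e e0.
(* The bound 1/2 keeps [q] positive; four errors of size at most B e' are added at the end, within 5
   B e' <= e. *)
pose e' := Num.min (e / (5 * B)) (1 / 2).
have e'0 : 0 < e' by rewrite lt_min !divr_gt0//; nra.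
have e'1 : e' <= 1 / 2 by rewrite ge_min lexx orbT.
have e'B : 5 * B * e' <= e.
  have : e' <= e / (5 * B) by rewrite ge_min lexx.
  by rewrite ler_pdivlMr 1?mulrC//; nra.
have [M1 HM1] := tightQ _ e'0; have [M2 HM2] := tightY _ e'0.
pose M := Num.max M1 M2.
have QM : 1 - e' <= Ex Q (trapezoid M) by apply: HM1; rewrite le_max lexx.
have YM : \forall n \near \oo, 1 - e' <= Ex P (fun w => trapezoid M (Y n w)).
  by apply: HM2; rewrite le_max lexx orbT.
pose chi := trapezoid M; have bchi : bmeas chi := trapezoid_bmeas M.
have bfchi : bmeas (fun x => f x * chi x) by exact: bmeasM.
pose q := Ex Q chi; have q0 : 0 < q by rewrite /q/chi; lra.
have q1 : q <= 1.
  rewrite -[leRHS](Ex_cst Q); apply: Ex_le => //; first exact: bmeas_cst.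
  by move=> x; case/andP: (trapezoid_itv M x).
have chi0 x : 0 <= chi x by case/andP: (trapezoid_itv M x).
have chi1 x : chi x <= 1 by case/andP: (trapezoid_itv M x).
pose a := Ex Q (fun x => f x * chi x) / q.
have aB : `|a| <= B.
  rewrite normrM normfV (gtr0_norm q0) ler_pdivrMr//.
  rewrite (le_trans (Ex_norm _ _))// /q -ExZ//; apply: Ex_le.
  - exact: bmeas_norm.
  - exact: bmeasZ.
  - by move=> x; rewrite normrM (ger0_norm (chi0 x)) ler_wpM2r.
pose D x := f x * chi x - a * chi x.
have bachi : bmeas (fun x => a * chi x) by exact: bmeasZ.
have cchi : continuous chi := @trapezoid_continuous R M.
have cD : continuous D.
  move=> x; apply: (@cvgB _ R^o); first by apply: cvgM; [exact: cf|exact: cchi].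
  by apply: cvgM; [exact: cvg_cst|exact: cchi].
have sD : supported D (M + 1).
  by move=> x xM; rewrite /D /chi trapezoid_supported// !mulr0 subrr.
have bD : bmeas D by exact: supported_bmeas sD.
have gD : gauss_mean s2 D = 0.
  by rewrite gE// ExB// ExZ// -/q /a divfK ?subrr// gt_eqF.
have D0 := cvgD0 D _ cD sD gD.
have bchic : bmeas (fun x => 1 - chi x) by apply: bmeasB => //; exact: bmeas_cst.
have bfc : bmeas (fun x => f x * (1 - chi x)) by exact: bmeasM.
have tail d (T : measurableType d) (S : probability T R) (k : T -> R) :
    measurable_fun setT k -> 1 - e' <= Ex S (fun w => chi (k w)) ->
    `|Ex S (fun w => f (k w) * (1 - chi (k w)))| <= B * e'.
  move=> mk Sk.
  have bchik : bmeas (fun w => chi (k w)) by exact: bmeas_comp bchi mk.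
  have bk1 : bmeas (fun w => f (k w) * (1 - chi (k w))) by exact: bmeas_comp bfc mk.
  have bk2 : bmeas (fun w => 1 - chi (k w)) by exact: bmeas_comp bchic mk.
  rewrite (le_trans (Ex_norm _ bk1))//.
  apply: (@le_trans _ _ (Ex S (fun w => B * (1 - chi (k w))))).
    apply: Ex_le; [exact: bmeas_norm|exact: bmeasZ|move=> w].
    by rewrite normrM [`|1 - _|]ger0_norm ?subr_ge0// ler_wpM2r// subr_ge0.
  rewrite ExZ// ExB//; last exact: bmeas_cst.
  by rewrite Ex_cst ler_wpM2l//; lra.
have Dn' : \forall n \near \oo, `|Ex P (fun w => D (Y n w))| <= B * e'.
  have Be : 0 < B * e' by rewrite mulr_gt0//; lra.
  move/cvgrPdist_le: D0 => /(_ _ Be); apply: filterS => n.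
  by rewrite sub0r normrN.
near=> n.
have Dn : `|Ex P (fun w => D (Y n w))| <= B * e' by near: n; exact: Dn'.
have Yn : 1 - e' <= Ex P (fun w => chi (Y n w)) by near: n; exact: YM.
have t1 := tail _ _ P (Y n) (mY n) Yn.
have t2 := tail _ _ Q id (@measurable_id _ _ _) QM.
have bchiY : bmeas (fun w => chi (Y n w)) by exact: bcomp.
have E1 : Ex P (fun w => f (Y n w)) = Ex P (fun w => D (Y n w))
    + a * Ex P (fun w => chi (Y n w)) + Ex P (fun w => f (Y n w) * (1 - chi (Y n w))).
  have bDY : bmeas (fun w => D (Y n w)) by exact: bcomp bD (mY n).
  have bfY : bmeas (fun w => f (Y n w) * (1 - chi (Y n w))) by exact: bcomp bfc (mY n).
  have baY : bmeas (fun w => a * chi (Y n w)) by exact: bmeasZ.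
  rewrite -ExZ// -!ExD//; last exact: bmeasD.
  by congr Ex; apply/funext => w; rewrite /D; ring.
have E2 : Ex Q f = a * q + Ex Q (fun x => f x * (1 - chi x)).
  rewrite /a divfK ?gt_eqF// -ExD//.
  by congr Ex; apply/funext => w; ring.
have Y1 : Ex P (fun w => chi (Y n w)) <= 1.
  rewrite -[leRHS](Ex_cst P); apply: Ex_le => //; exact: bmeas_cst.
have a1 : `|a * (Ex P (fun w => chi (Y n w)) - q)| <= B * e'.
  have Qq : 1 - e' <= q by exact: QM.
  by rewrite normrM ler_pM// ler_norml; apply/andP; split; lra.
rewrite E1 E2.
have -> : a * q + Ex Q (fun x => f x * (1 - chi x)) - (Ex P (fun w => D (Y n w))
    + a * Ex P (fun w => chi (Y n w)) + Ex P (fun w => f (Y n w) * (1 - chi (Y n w))))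
  = Ex Q (fun x => f x * (1 - chi x)) - Ex P (fun w => D (Y n w))
    - a * (Ex P (fun w => chi (Y n w)) - q)
    - Ex P (fun w => f (Y n w) * (1 - chi (Y n w))) by ring.
move: t1 t2 a1 Dn; rewrite !ler_norml => /andP[? ?] /andP[? ?] /andP[? ?] /andP[? ?].
have : 0 <= B * e' by rewrite mulr_ge0// ?ltW//; lra.
by move=> ?; apply/andP; split; lra.
Unshelve. all: by end_near. Qed.

(** Where [Y] and [S] are within [del], uniform continuity costs e / 2; elsewhere the cost is 2 B
    times a vanishing probability. *)
Lemma slutsky_Ex (D : R -> R) (S Y : nat -> Om -> R) : bmeas D -> unif_cont D ->
  (forall n, measurable_fun [set: Om] (S n)) ->
  (forall n, measurable_fun [set: Om] (Y n)) ->
  (forall del : R, 0 < del ->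
     Pr P [set w | del <= `|Y n w - S n w|] @[n --> \oo] --> (0 : R)) ->
  Ex P (fun w => D (Y n w)) - Ex P (fun w => D (S n w)) @[n --> \oo] --> (0 : R).
Proof.
move=> bD uc mS mY cvgYS; have [B0 DB0] := proj2 bD.
pose B := `|B0| + 1; have B1 : 1 <= B by rewrite lerDr.
have DB x : `|D x| <= B by rewrite (le_trans (DB0 x))// (le_trans (ler_norm _))// lerDl.
apply/cvgrPdist_le => e e0.
have e20 : 0 < e / 2 by rewrite divr_gt0.
have [del del0 ucd] := uc _ e20.
have eB : 0 < e / (4 * B) by rewrite divr_gt0//; lra.
have PC' : \forall n \near \oo, Pr P [set w | del <= `|Y n w - S n w|] <= e / (4 * B).
  move/cvgrPdist_le: (cvgYS del del0) => /(_ _ eB); apply: filterS => n.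
  by rewrite sub0r normrN => /(le_trans (ler_norm _)).
near=> n; rewrite sub0r normrN.
have : Pr P [set w | del <= `|Y n w - S n w|] <= e / (4 * B) by near: n; exact: PC'.
set C := [set w | _] => PC.
have mC : measurable C.
  rewrite (_ : C = (fun w => `|Y n w - S n w|) @^-1` `[del, +oo[%classic); last first.
    by apply/seteqP; split => w; rewrite /C /= in_itv/= andbT.
  rewrite -[X in measurable X]setTI; apply: measurableT_comp => //.
  exact: measurable_funB.
have bY : bmeas (fun w => D (Y n w)) by exact: bcomp.
have bS : bmeas (fun w => D (S n w)) by exact: bcomp.
have bC : bmeas (fun w => 2 * B * \1_C w) by apply: bmeasZ; exact: bmeas_indic.
have be : bmeas (fun w : Om => e / 2) by exact: bmeas_cst.
rewrite -ExB// (le_trans (Ex_norm _ _))//; first exact: bmeasB.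
apply: (@le_trans _ _ (Ex P (fun w => e / 2 + 2 * B * \1_C w))).
  apply: Ex_le; [by apply: bmeas_norm; exact: bmeasB|exact: bmeasD|move=> w].
  rewrite indicE; case: (boolP (w \in C)) => [_|/negP wC].
    rewrite mulr1 (le_trans (ler_normB _ _))//.
    by have := DB (Y n w); have := DB (S n w); lra.
  rewrite mulr0 addr0; apply: ucd; rewrite ltNge; apply/negP => H.
  by apply: wC; rewrite inE.
rewrite ExD// Ex_cst ExZ; last exact: bmeas_indic.
rewrite Ex_indic//; have : 2 * B * Pr P C <= 2 * B * (e / (4 * B)).
  by rewrite ler_wpM2l//; lra.
have -> : 2 * B * (e / (4 * B)) = e / 2 by field; rewrite gt_eqF//; lra.
lra.
Unshelve. all: by end_near. Qed.

(** Tightness and the limit for test functions of Gaussian mean zero are established for [nsum U]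
    and carried over to [Y] by [slutsky_Ex]. *)
Lemma central_limit_slutsky (U : nat -> Om -> R) (Y : nat -> Om -> R) :
  iid_bounded P U -> Ex P (U 0%N) = 0 ->
  (forall n, measurable_fun [set: Om] (Y n)) ->
  (forall del : R, 0 < del ->
     Pr P [set w | del <= `|Y n w - nsum U n w|] @[n --> \oo] --> (0 : R)) ->
  cvg_dist_normal P Y (Ex P (fun w => U 0%N w ^+ 2)).
Proof.
move=> iidU EU mY cvgY; set s2 := Ex P _.
have s20 : 0 <= s2 by apply: Ex_ge0 => w; exact: sqr_ge0.
have bS n : bmeas (nsum U n) by exact: nsum_bmeas iidU n.
have mS n : measurable_fun [set: Om] (nsum U n) by case: (bS n).
have bS2 n : bmeas (fun w => nsum U n w ^+ 2) by exact: bmeasX.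
apply: cvg_dist_normal_tight => // [D M cD sD gD|e e0]; last first.
  (* Since [trapezoid] is at least 1 - x^2 / M^2, the sum loses at most s2 / M^2 <= e / 2; the other
     half pays for passing to [Y]. The + 1 keeps [M] positive. *)
  pose M0 := Num.sqrt (2 * s2 / e) + 1; exists M0 => M M0M.
  have Mp : 0 < M by apply: lt_le_trans M0M; rewrite ltr_wpDl// sqrtr_ge0.
  have s2M : s2 / M ^+ 2 <= e / 2.
    have se0 : 0 <= 2 * s2 / e by rewrite divr_ge0 ?mulr_ge0// ltW.
    have sM : Num.sqrt (2 * s2 / e) <= M by rewrite (le_trans _ M0M)// lerDl.
    have : 2 * s2 / e <= M ^+ 2.
      by rewrite -(sqr_sqrtr se0) lerXn2r ?nnegrE ?sqrtr_ge0// ltW.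
    rewrite !ler_pdivrMr ?exprn_gt0//; lra.
  have e20 : 0 < e / 2 by rewrite divr_gt0.
  have uT := supported_unif_cont (@trapezoid_continuous R M) (@trapezoid_supported R M).
  have := slutsky_Ex (trapezoid_bmeas M) uT mS mY cvgY.
  move=> /cvgrPdist_le/(_ _ e20) => H; near=> n.
  have n0 : (0 < n)%N by near: n; exists 1%N.
  have : `|0 - (Ex P (fun w => trapezoid M (Y n w)) -
      Ex P (fun w => trapezoid M (nsum U n w)))| <= e / 2 by near: n; exact: H.
  have : 1 - s2 / M ^+ 2 <= Ex P (fun w => trapezoid M (nsum U n w)).
    have ES : Ex P (fun w => nsum U n w ^+ 2) = s2 by exact: Ex_nsum_sqr.
    rewrite -ES mulrC -ExZ// -[X in X - _](Ex_cst P).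
    rewrite -ExB; [|exact: bmeas_cst|exact: bmeasZ].
    apply: Ex_le; [|exact: bcomp (trapezoid_bmeas M) (mS n)|move=> w].
      by apply: bmeasB; [exact: bmeas_cst|exact: bmeasZ].
    have [xM|xM] := leP `|nsum U n w| M.
      by rewrite trapezoid1// gerBl mulr_ge0 ?sqr_ge0// invr_ge0 sqr_ge0.
    apply: (@le_trans _ _ 0); last by case/andP: (trapezoid_itv M (nsum U n w)).
    rewrite subr_le0 mulrC ler_pdivlMr ?exprn_gt0// mul1r -[leRHS]real_normK ?num_real//.
    by rewrite lerXn2r ?nnegrE// ltW.
  by rewrite sub0r normrN ler_norml => ? /andP[? _]; lra.
have bD := supported_bmeas cD sD; have uD := supported_unif_cont cD sD.
suff H : Ex P (fun w => D (nsum U n w)) @[n --> \oo] --> (0 : R).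
  rewrite -[0]addr0; rewrite (_ : (fun n => Ex P (fun w => D (Y n w))) = fun n =>
    (Ex P (fun w => D (Y n w)) - Ex P (fun w => D (nsum U n w)))
    + Ex P (fun w => D (nsum U n w))); last by apply/funext => n; rewrite subrK.
  by apply: (@cvgD _ R^o) => //; exact: slutsky_Ex.
(* In the degenerate case [gauss_mean] is evaluation at 0, so D 0 = 0; then |D x| <= e + B x^2 /
   del^2, and the second moment of [nsum] is zero. *)
have [s2E|s2N] := eqVneq s2 0.
  have D0 : D 0 = 0 by move: gD; rewrite /gauss_mean s2E eqxx.
  have [B0 DB0] := proj2 bD; pose B := `|B0|.
  have DB x : `|D x| <= B by rewrite (le_trans (DB0 x))// ler_norm.
  apply/cvgrPdist_le => e e0; have [del del0 ucd] := uD e e0.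
  near=> n; rewrite sub0r normrN.
  have n0 : (0 < n)%N by near: n; exists 1%N.
  rewrite (le_trans (Ex_norm _ _))//; first exact: bcomp bD (mS n).
  have bE : bmeas (fun w => B / del ^+ 2 * nsum U n w ^+ 2) by exact: bmeasZ.
  have -> : e = Ex P (fun w => e + B / del ^+ 2 * nsum U n w ^+ 2).
    rewrite ExD//; last exact: bmeas_cst.
    by rewrite Ex_cst ExZ// (Ex_nsum_sqr iidU)// -/s2 s2E mulr0 addr0.
  apply: Ex_le; [by apply: bmeas_norm; exact: bcomp bD (mS n)| |move=> w].
    by apply: bmeasD => //; exact: bmeas_cst.
  have B0' : 0 <= B by exact: normr_ge0.
  have [xd|xd] := ltP `|nsum U n w - 0| del.
    have := ucd _ _ xd; rewrite D0 subr0 => /le_trans; apply; rewrite lerDl.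
    by rewrite mulr_ge0 ?sqr_ge0// divr_ge0 ?sqr_ge0.
  rewrite subr0 in xd; rewrite (le_trans (DB _))// -[leLHS]add0r lerD ?(ltW e0)//.
  rewrite -mulrA -[leLHS]mulr1 ler_wpM2l// mulrC ler_pdivlMr ?exprn_gt0// mul1r.
  by rewrite -[leRHS]real_normK ?num_real// lerXn2r ?nnegrE ?(ltW del0).
have s2p : 0 < s2 by rewrite lt_neqAle eq_sym s2N.
have sg0 : 0 < Num.sqrt s2 by rewrite sqrtr_gt0.
have ED : Ex (normal_prob 0 (Num.sqrt s2) : probability (measurableTypeR R) R) D = 0.
  by move: gD; rewrite /gauss_mean (negbTE s2N) /Ex unlock.
have [phi [psi [dphi cpsi sphi spsi E]]] := stein_solution sg0 cD sD ED.
have cphi : continuous phi.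
  move=> y; apply: differentiable_continuous; apply/derivable1_diffP.
  by have [] := dphi y.
have := stein_limit iidU EU dphi (supported_bmeas cphi sphi) (supported_bmeas cpsi spsi)
  (supported_unif_cont cpsi spsi).
rewrite -/s2; under eq_fun do under eq_fun do rewrite -[X in X * _](sqr_sqrtr s20) E.
by [].
Unshelve. all: by end_near. Qed.

End central_limit.

(** * Data triples, conditional laws and the operator F *)

Section triples.
Context {R : realType} {dO : measure_display} {Om : measurableType dO}
  {dX : measure_display} {X : measurableType dX} {A : finType}.

Lemma measurable_inv : measurable_fun [set: R] (@GRing.inv R).
Proof.
rewrite -(setvU [set 0]); apply/measurable_funU => //; first exact: measurableC.
split; last exact: measurable_fun_set1.
apply: open_continuous_measurable_fun.
  by rewrite openC; apply: accessible_closed_set1; exact: hausdorff_accessible (@Rhausdorff R).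
by apply/in_setP => x /= /eqP x0; exact: inv_continuous.
Qed.

Definition triple_meas_fun (h : X * A * R -> R) :=
  forall a, measurable_fun [set: X * R] (fun xr => h (xr.1, a, xr.2)).

Lemma triple_meas_fun_add h k : triple_meas_fun h -> triple_meas_fun k ->
  triple_meas_fun (fun z => h z + k z).
Proof. by move=> mh mk a; apply: measurable_funD; [exact: mh|exact: mk]. Qed.

Lemma triple_meas_fun_mul h k : triple_meas_fun h -> triple_meas_fun k ->
  triple_meas_fun (fun z => h z * k z).
Proof. by move=> mh mk a; apply: measurable_funM; [exact: mh|exact: mk]. Qed.

Lemma triple_meas_fun_opp h : triple_meas_fun h -> triple_meas_fun (fun z => - h z).
Proof. by move=> mh a; apply: measurableT_comp => //; exact: mh. Qed.

Lemma triple_meas_fun_cst c : triple_meas_fun (fun=> c).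
Proof. by move=> a; exact: measurable_cst. Qed.

Lemma triple_meas_fun_sum I (r : seq I) h : (forall i, triple_meas_fun (h i)) ->
  triple_meas_fun (fun z => \sum_(i <- r) h i z).
Proof. by move=> mh a; apply: measurable_sum => i; exact: mh. Qed.

Lemma triple_meas_fun_xa (k : X -> A -> R) :
  (forall a, measurable_fun setT (k ^~ a)) -> triple_meas_fun (fun z => k z.1.1 z.1.2).
Proof.
by move=> mk a; apply: (measurableT_comp (mk a) measurable_fst).
Qed.

Lemma triple_meas_fun_r : triple_meas_fun (fun z => z.2).
Proof. by move=> a; exact: measurable_snd. Qed.

Lemma triple_meas_fun_comp (Z : Om -> X * A * R) h :
  rand_elt_measurable Z -> triple_meas_fun h -> measurable_fun setT (h \o Z).
Proof.
move=> mZ mh _ B mB; rewrite setTI comp_preimage; apply: mZ => a.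
by rewrite -[X in measurable X]setTI; exact: mh.
Qed.

Variable P : probability Om R.

Lemma iid_bounded_comp (Z : nat -> Om -> X * A * R) (h : X * A * R -> R) :
  iid_seq P Z -> triple_meas_fun h -> (exists M : R, forall i w, `|h (Z i w)| <= M) ->
  iid_bounded P (fun i w => h (Z i w)).
Proof.
move=> [mZ dZ iZ] mh bh.
have mS (B : set R) : measurable B -> triple_measurable (h @^-1` B).
  by move=> mB a; rewrite -[X in measurable X]setTI; exact: mh.
split=> //.
- by move=> i; exact: triple_meas_fun_comp (mZ i) mh.
- by move=> i B mB; rewrite /Pr (dZ i (h @^-1` B))//; exact: mS.
- by move=> s B us mB; apply: (iZ s (fun i => h @^-1` B i)) => // i; exact: mS.
Qed.

Variable Z : Om -> X * A * R.
Hypothesis mZ : rand_elt_measurable Z.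
Let x0 w := (Z w).1.1.
Let a0 w := (Z w).1.2.
Let r0 w := (Z w).2.

Lemma measurable_context : measurable_fun setT x0.
Proof.
move=> _ B mB; rewrite setTI; apply: (mZ (S := [set z | B z.1.1])) => a.
by rewrite -[X in measurable X]setTI; exact: measurable_fst.
Qed.

Lemma measurable_context_action (B : set X) (a : A) : measurable B ->
  measurable (Z @^-1` [set z | B z.1.1 /\ z.1.2 = a]).
Proof.
move=> mB; apply: mZ => a'; have [->|a'a] := eqVneq a' a.
  rewrite (_ : [set xr | _] = fst @^-1` B); last by apply/seteqP; split => x //= [].
  by rewrite -[X in measurable X]setTI; exact: measurable_fst.
rewrite (_ : [set xr | _] = set0)//; apply/seteqP; split => x //= [_ /eqP].
by rewrite (negbTE a'a).
Qed.

Let ind (a : A) (w : Om) : R := (a0 w == a)%:R.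

Let indE (B : set X) a w :
  \1_B (x0 w) * ind a w = \1_(Z @^-1` [set z | B z.1.1 /\ z.1.2 = a]) w.
Proof.
rewrite /ind !indicE -natrM mulnb; congr (_%:R); congr nat_of_bool.
apply/idP/idP => [/andP[/set_mem xB /eqP ?]|/set_mem[xB ?]]; first exact/mem_set.
by apply/andP; split; [exact/mem_set|exact/eqP].
Qed.

Let bind a : bmeas (ind a).
Proof.
have -> : ind a = \1_(Z @^-1` [set z | setT z.1.1 /\ z.1.2 = a]).
  by apply/funext => w; rewrite -indE indicE in_setT mul1r.
by apply: bmeas_indic; exact: measurable_context_action.
Qed.

(** Reduces functions of context and action to functions of the context at a fixed action, the form
    in which [behavior_cond] and [cond_mean_reward] are stated. *)
Let sum_ind (k : X -> A -> R) w : k (x0 w) (a0 w) = \sum_a k (x0 w) a * ind a w.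
Proof.
rewrite (bigD1 (a0 w))//= /ind eqxx mulr1 big1 ?addr0// => a.
by rewrite eq_sym => /negbTE ->; rewrite mulr0.
Qed.

Lemma bmeas_context (f : X -> R) : bmeas f -> bmeas (fun w => f (x0 w)).
Proof. by move=> bf; exact: bmeas_comp bf measurable_context. Qed.

Lemma bmeas_context_action (k : X -> A -> R) : (forall a, bmeas (k ^~ a)) ->
  bmeas (fun w => k (x0 w) (a0 w)).
Proof.
move=> bk; under eq_fun do rewrite sum_ind; apply: bmeas_sum => a.
by apply: bmeasM => //; exact: (bmeas_context (bk a)).
Qed.

Lemma Ex_action (pi_b : X -> A -> R) (k : X -> A -> R) :
  behavior_cond P Z pi_b -> (forall a, bmeas (pi_b ^~ a)) -> (forall a, bmeas (k ^~ a)) ->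
  Ex P (fun w => k (x0 w) (a0 w)) = Ex P (fun w => \sum_a k (x0 w) a * pi_b (x0 w) a).
Proof.
move=> beh bpi bk; under eq_fun do rewrite sum_ind.
have bkx a : bmeas (fun w => k (x0 w) a) by exact: (bmeas_context (bk a)).
have bpix a : bmeas (fun w => pi_b (x0 w) a) by exact: (bmeas_context (bpi a)).
rewrite !Ex_sum; [|by move=> a; exact: bmeasM..].
apply: eq_bigr => a _.
apply: (bfunctional_eq (L1 := fun f : X -> R => Ex P (fun w => f (x0 w) * ind a w))
  (L2 := fun f : X -> R => Ex P (fun w => f (x0 w) * pi_b (x0 w) a)) _ _ _ (bk a)).
- exact: (bfunctional_Ex P measurable_context).
- exact: (bfunctional_Ex P measurable_context).
- move=> B mB; under eq_fun do rewrite indE.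
  by rewrite Ex_indic; [exact: beh|exact: measurable_context_action].
Qed.

Lemma Ex_reward_residual (Q k : X -> A -> R) : cond_mean_reward P Z Q ->
  bmeas r0 -> (forall a, bmeas (Q ^~ a)) -> (forall a, bmeas (k ^~ a)) ->
  Ex P (fun w => (r0 w - Q (x0 w) (a0 w)) * k (x0 w) (a0 w)) = 0.
Proof.
move=> condQ br bQ bk.
have bkx a : bmeas (fun w => k (x0 w) a) by exact: (bmeas_context (bk a)).
have bQz := bmeas_context_action bQ.
have bri a : bmeas (fun w => r0 w * ind a w) by exact: bmeasM.
have bQi a : bmeas (fun w => Q (x0 w) (a0 w) * ind a w) by exact: bmeasM.
have E w : (r0 w - Q (x0 w) (a0 w)) * k (x0 w) (a0 w) =
    \sum_a (k (x0 w) a * (r0 w * ind a w) - k (x0 w) a * (Q (x0 w) (a0 w) * ind a w)).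
  by rewrite (sum_ind k) mulr_sumr; apply: eq_bigr => a _; ring.
under eq_fun do rewrite E.
rewrite Ex_sum; last by move=> a; apply: bmeasB; exact: bmeasM.
rewrite big1// => a _; rewrite ExB; [|exact: bmeasM..].
apply/eqP; rewrite subr_eq0; apply/eqP.
apply: (bfunctional_eq (L1 := fun f : X -> R => Ex P (fun w => f (x0 w) * (r0 w * ind a w)))
  (L2 := fun f : X -> R => Ex P (fun w => f (x0 w) * (Q (x0 w) (a0 w) * ind a w))) _ _ _ (bk a)).
- exact: (bfunctional_Ex P measurable_context).
- exact: (bfunctional_Ex P measurable_context).
- move=> B mB; pose S := [set z : X * A * R | B z.1.1 /\ z.1.2 = a].
  transitivity (Ex P (fun w => (Z w).2 * \1_S (Z w))).
    by congr Ex; apply/funext => w; rewrite mulrCA indE.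
  by rewrite (condQ B a mB); congr Ex; apply/funext => w; rewrite mulrCA indE.
Qed.

Section weighted.
Variables pi_b pi_e : X -> A -> R.
Hypotheses (polb : policy pi_b) (pole : policy pi_e).
Hypothesis overlap : forall x a, 0 < pi_e x a -> 0 < pi_b x a.
Hypothesis bounded_weight : exists C : R, forall x a, weight pi_e pi_b x a <= C.
Hypothesis beh : behavior_cond P Z pi_b.

Lemma policy_bmeas (p : X -> A -> R) : policy p -> forall a, bmeas (p ^~ a).
Proof.
move=> [mp p0 p1] a; split=> //; exists 1 => x.
rewrite ger0_norm// -(p1 x) (bigD1 a)//= lerDl; exact: sumr_ge0.
Qed.

Lemma weight_bmeas a : bmeas (fun x => weight pi_e pi_b x a).
Proof.
have [mb b0 _] := polb; have [me e0 _] := pole; have [C wC] := bounded_weight.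
split; last by exists C => x; rewrite ger0_norm// divr_ge0.
by apply: measurable_funM => //; apply: (measurableT_comp measurable_inv).
Qed.

Lemma Fop_bmeas (m : X -> A -> R) : (forall a, bmeas (m ^~ a)) ->
  forall a, bmeas (fun x => Fop pi_e pi_b m x a).
Proof.
move=> bm a; apply: bmeasB; first by apply: bmeasM; [exact: weight_bmeas|exact: bm].
by apply: bmeas_sum => a'; apply: bmeasM; [exact: bm|exact: policy_bmeas].
Qed.

(** Where [pi_b] vanishes the left side is zero, and overlap forces [pi_e] to vanish as well. *)
Lemma weight_mul x a : weight pi_e pi_b x a * pi_b x a = pi_e x a.
Proof.
have [_ b0 _] := polb; have [_ e0 _] := pole.
have [pb0|pbN] := eqVneq (pi_b x a) 0; last by rewrite /weight divfK.
rewrite pb0 mulr0; apply/eqP; rewrite eq_le e0 leNgt; apply/negP => /overlap.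
by rewrite pb0 ltxx.
Qed.

(* Conditionally on the context, [w m] has mean [\sum_a' m pi_e]. *)
Lemma Ex_Fop (phi : X -> R) (m : X -> A -> R) : bmeas phi -> (forall a, bmeas (m ^~ a)) ->
  Ex P (fun w => phi (x0 w) * Fop pi_e pi_b m (x0 w) (a0 w)) = 0.
Proof.
move=> bphi bm; have [_ _ b1] := polb.
rewrite (Ex_action (k := fun x a => phi x * Fop pi_e pi_b m x a) beh); last 2 first.
- exact: policy_bmeas.
- by move=> a; apply: bmeasM => //; exact: Fop_bmeas.
rewrite -[RHS](Ex_cst P); congr Ex; apply/funext => w.
under eq_bigr do rewrite -mulrA.
rewrite -mulr_sumr /Fop; apply/eqP; rewrite mulf_eq0; apply/orP; right; apply/eqP.
under eq_bigr do rewrite mulrBl mulrAC weight_mul.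
by rewrite sumrB -mulr_sumr b1 mulr1; apply/eqP; rewrite subr_eq0; apply/eqP;
  apply: eq_bigr => a _; rewrite mulrC.
Qed.

End weighted.
End triples.

(** * Negligibility of the remainder *)

Section remainder.
Context {R : realType} {dO : measure_display} {Om : measurableType dO}.
Variable P : probability Om R.

(* A remainder of order [sqrt n Theta_n], with [Theta_n] of mean [O(1/n)], is
   negligible by Markov's inequality. *)
Lemma remainder_cvg0 (Theta Del : nat -> Om -> R) (E : nat -> set Om) (C del0 v : R) :
  0 <= C -> 0 < del0 -> 0 <= v ->
  (forall n, bmeas (Theta n)) -> (forall n w, 0 <= Theta n w) ->
  (forall n, (0 < n)%N -> Ex P (Theta n) = v / n%:R) ->
  (forall n, measurable_fun [set: Om] (Del n)) ->
  (forall n, measurable (E n)) -> Pr P (E n) @[n --> \oo] --> (1 : R) ->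
  (forall n w, (0 < n)%N -> E n w -> Theta n w <= del0 ->
     `|Del n w| <= Num.sqrt n%:R * (C * Theta n w)) ->
  forall del : R, 0 < del -> Pr P [set w | del <= `|Del n w|] @[n --> \oo] --> (0 : R).
Proof.
move=> C0 d0 v0 bT T0 ET mD mE cvgE DT del dp.
apply/cvgrPdist_le => e e0.
have e30 : 0 < e / 3 by rewrite divr_gt0.
have E1 : \forall n \near \oo, 1 - Pr P (E n) <= e / 3.
  move/cvgrPdist_le: cvgE => /(_ _ e30); apply: filterS => n.
  by move=> /(le_trans (ler_norm _)).
near=> n; rewrite sub0r normrN.
have n0 : (0 < n)%N by near: n; exists 1%N.
have nR : 0 < n%:R :> R by rewrite ltr0n.
have En : 1 - Pr P (E n) <= e / 3 by near: n; exact: E1.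
have n1 : v / del0 / n%:R <= e / 3.
  rewrite ler_pdivrMr// [e / 3 * _]mulrC -ler_pdivrMr//.
  by apply: ltW; near: n; exact: nbhs_infty_gtr.
pose sn : R := Num.sqrt n%:R.
have sn0 : 0 < sn by rewrite sqrtr_gt0.
have n2 : C / del * v / sn <= e / 3.
  have Q0 : 0 <= C / del * v / (e / 3).
    by rewrite divr_ge0 ?(ltW e30)// mulr_ge0// divr_ge0// ltW.
  rewrite ler_pdivrMr// [e / 3 * _]mulrC -ler_pdivrMr// -[leLHS](ger0_norm Q0) -sqrtr_sqr.
  rewrite ler_sqrt//; apply: ltW. near: n; exact: nbhs_infty_gtr.
set B := [set w | _].
have mB : measurable B.
  rewrite (_ : B = (fun w => `|Del n w|) @^-1` `[del, +oo[%classic); last first.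
    by apply/seteqP; split => w; rewrite /B /= in_itv/= andbT.
  by rewrite -[X in measurable X]setTI; exact: measurableT_comp.
have /andP[PB0 _] := Pr_bound P mB; rewrite ger0_norm//.
(* Chosen so that the indicator of [B] is at most 1 - 1_E + k Theta: either [E n] fails, or Theta /
   del0 exceeds 1, or the assumed bound gives del <= sn C Theta. The three expectations get e / 3
   each. *)
pose k : R := del0^-1 + C * sn / del.
have bE : bmeas (\1_(E n) : Om -> R) by exact: bmeas_indic.
have bE1 : bmeas (fun w => 1 - \1_(E n) w : R) by apply: bmeasB => //; exact: bmeas_cst.
have bkT : bmeas (fun w => k * Theta n w) by exact: bmeasZ.
have kT : Pr P B <= Ex P (fun w => (1 - \1_(E n) w) + k * Theta n w).
  rewrite -Ex_indic//; apply: Ex_le; [exact: bmeas_indic|exact: bmeasD|move=> w].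
  have T1 : 0 <= Theta n w / del0 by rewrite divr_ge0// ltW.
  have T2 : 0 <= C * sn / del * Theta n w.
    by rewrite mulr_ge0// divr_ge0 ?(ltW dp)// mulr_ge0// ltW.
  have kE : k * Theta n w = Theta n w / del0 + C * sn / del * Theta n w.
    by rewrite /k mulrDl [del0^-1 * _]mulrC.
  rewrite kE !indicE; case: (boolP (w \in B)) => [/set_mem wB|_] /=; last first.
    by case: (w \in E n); rewrite /=; lra.
  case: (boolP (w \in E n)) => [/set_mem wE|_] /=; last by lra.
  have [Td|Td] := leP (Theta n w) del0.
    have : del <= sn * (C * Theta n w) by exact: le_trans wB (DT _ _ n0 wE Td).
    have -> : C * sn / del * Theta n w = sn * (C * Theta n w) / del by ring.
    by rewrite -[X in X <= _]mul1r -ler_pdivlMr//; lra.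
  have : 1 <= Theta n w / del0 by rewrite ler_pdivlMr// mul1r ltW.
  by lra.
apply: le_trans kT _.
rewrite ExD// ExB//; last exact: bmeas_cst.
rewrite Ex_cst Ex_indic// ExZ// ET//.
have -> : k * (v / n%:R) = v / del0 / n%:R + C / del * v / sn.
  have -> : n%:R = sn ^+ 2 :> R by rewrite sqr_sqrtr// ltW.
  by rewrite /k; field; rewrite !gt_eqF.
lra.
Unshelve. all: by end_near. Qed.

End remainder.

(** * Coefficient vectors and least squares *)

Section coefficients.
Context {R : realType} {dX : measure_display} {X : measurableType dX} {A : finType}.
Variables (d : nat) (t : 'I_d -> X -> A -> R) (pi_e pi_b : X -> A -> R).

Definition coef (xi : R) (tau : 'I_d -> R) (k : 'I_d.+1) : R :=
  if unlift ord0 k is Some j then tau j else xi.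

Lemma coefK (c : 'I_d.+1 -> R) : coef (c ord0) (fun j => c (lift ord0 j)) = c.
Proof. by apply/funext => k; rewrite /coef; case: unliftP => [j ->|->]. Qed.

Lemma Fop_model xi tau x a : Fop pi_e pi_b (model t xi tau) x a =
  \sum_k coef xi tau k * Fop pi_e pi_b (basis_fn t k) x a.
Proof.
have mE x' a' : model t xi tau x' a' = \sum_k coef xi tau k * basis_fn t k x' a'.
  rewrite big_ord_recl /model /coef /basis_fn unlift_none mulr1; congr (_ + _).
  by apply: eq_bigr => j _; rewrite liftK.
rewrite /Fop mE; under [in RHS]eq_bigr do rewrite mulrBr.
rewrite sumrB mulr_sumr; congr (_ - _); first by apply: eq_bigr => k _; rewrite mulrCA.
under eq_bigr do rewrite mE mulr_suml.
rewrite exchange_big/=; apply: eq_bigr => k _; rewrite mulr_sumr.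
by apply: eq_bigr => a' _; rewrite mulrA.
Qed.

End coefficients.

Section least_squares.
Context {R : realType} {dO : measure_display} {Om : measurableType dO}.
Variable P : probability Om R.

Lemma Var_shift (f : Om -> R) (c : R) : bmeas f -> Var P (fun w => f w - c) = Var P f.
Proof.
move=> bf; have bc : bmeas (fun _ : Om => c) by exact: bmeas_cst.
have bf2 : bmeas (fun w => f w ^+ 2) by exact: bmeasX.
have bcf : bmeas (fun w => (2 * c) * f w) by exact: bmeasZ.
have b2 : bmeas (fun w => f w ^+ 2 - (2 * c) * f w) by exact: bmeasB.
rewrite /Var ExB// Ex_cst.
have -> : Ex P (fun w => (f w - c) ^+ 2) = Ex P (fun w => f w ^+ 2) - (2 * c) * Ex P f + c ^+ 2.
  rewrite -ExZ// -ExB// -[c ^+ 2](Ex_cst P) -ExD//; last exact: bmeas_cst.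
  by congr Ex; apply/funext => w; ring.
by ring.
Qed.

(** Pythagoras: changing the coefficients adds to the residual an element of the span, which is
    orthogonal to it. *)
Lemma normal_equations_min m (q : Om -> R) (g : 'I_m -> Om -> R) (b : 'I_m -> R) :
  bmeas q -> (forall k, bmeas (g k)) ->
  (forall l, Ex P (fun w => (q w - \sum_k b k * g k w) * g l w) = 0) ->
  forall c : 'I_m -> R, Ex P (fun w => (q w - \sum_k b k * g k w) ^+ 2) <=
    Ex P (fun w => (q w - \sum_k c k * g k w) ^+ 2).
Proof.
move=> bq bg orth c.
have blin (a : 'I_m -> R) : bmeas (fun w => \sum_k a k * g k w).
  by apply: bmeas_sum => k; exact: bmeasZ.
pose e w := q w - \sum_k b k * g k w.
pose h w := \sum_k (b k - c k) * g k w.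
have be : bmeas e by exact: bmeasB.
have bh : bmeas h by exact: blin.
have E w : (q w - \sum_k c k * g k w) ^+ 2 = e w ^+ 2 + 2 * (e w * h w) + h w ^+ 2.
  have -> : q w - \sum_k c k * g k w = e w + h w.
    rewrite /e /h; under [X in _ = _ + X]eq_bigr do rewrite mulrBl.
    by rewrite sumrB; ring.
  by ring.
have eh : Ex P (fun w => e w * h w) = 0.
  under eq_fun do rewrite /h mulr_sumr.
  rewrite Ex_sum; last by move=> k; apply: bmeasM => //; exact: bmeasZ.
  rewrite big1// => k _; under eq_fun do rewrite mulrCA.
  by rewrite ExZ ?orth ?mulr0//; exact: bmeasM.
have -> : Ex P (fun w => (q w - \sum_k c k * g k w) ^+ 2) =
    Ex P (fun w => e w ^+ 2 + 2 * (e w * h w) + h w ^+ 2).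
  by congr Ex; apply/funext => w; exact: E.
have b1 : bmeas (fun w => e w ^+ 2) by exact: bmeasX.
have b2 : bmeas (fun w => e w * h w) by exact: bmeasM.
have b3 : bmeas (fun w => h w ^+ 2) by exact: bmeasX.
have b4 : bmeas (fun w => 2 * (e w * h w)) by exact: bmeasZ.
rewrite ExD//; last exact: bmeasD.
rewrite ExD// ExZ// eh mulr0 addr0 lerDl.
by apply: Ex_ge0 => w; exact: sqr_ge0.
Qed.

End least_squares.

(** * Asymptotic normality of [beta_emp] and its efficiency consequences *)

Unset Implicit Arguments.

Theorem theorem2 (R : realType) (dO : measure_display) (Om : measurableType dO)
  (P : probability Om R) (dX : measure_display) (X : measurableType dX)
  (A : finType) (pi_b pi_e : X -> A -> R) (Rmax : R)
  (d : nat) (t : 'I_d -> X -> A -> R)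
  (Z : nat -> Om -> X * A * R)
  (xi_hat : nat -> Om -> R) (tau_hat : nat -> Om -> 'I_d -> R)
  (E : nat -> set Om) :
  policy pi_b -> policy pi_e ->
  (* overlap *)
  (forall x a, 0 < pi_e x a -> 0 < pi_b x a) ->
  (* bounded weights *)
  (exists C, forall x a, weight pi_e pi_b x a <= C) ->
  (* data: i.i.d. triples, a | x ~ pi_b(.|x), r in [0, Rmax] *)
  iid_seq P Z ->
  behavior_cond P (Z 0%N) pi_b ->
  (forall i w, 0 <= (Z i w).2 <= Rmax) ->
  (* basis functions: measurable, bounded, linearly independent with 1 *)
  (forall j a, measurable_fun setT (fun x => t j x a)) ->
  (exists C, forall j x a, `|t j x a| <= C) ->
  lin_indep_with_const t ->
  (* E[g g^T] nonsingular *)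
  gram P (Z 0%N) pi_e pi_b t \in unitmx ->
  (* estimators: measurable, maximizers of the empirical objective on events
     E n whose probability tends to one *)
  (forall n, measurable_fun setT (xi_hat n)) ->
  (forall n j, measurable_fun setT (fun w => tau_hat n w j)) ->
  (forall n, measurable (E n)) ->
  (forall n w, E n w ->
     is_emp_max Z pi_e pi_b t n (xi_hat n w) (tau_hat n w) w) ->
  (fun n => Pr P (E n)) @ \oo --> (1 : R) ->
  let x0 w := (Z 0%N w).1.1 in
  let a0 w := (Z 0%N w).1.2 in
  let r0 w := (Z 0%N w).2 in
  let w0 w := weight pi_e pi_b (x0 w) (a0 w) in
  let beta_star := Ex P (fun w => w0 w * r0 w) in
  let V zeta tau := Ex P (fun w =>
      (w0 w * r0 w - Fop pi_e pi_b (model t zeta tau) (x0 w) (a0 w)) ^+ 2)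
      - beta_star ^+ 2 in
  exists sigma2 : R,
    (* sqrt n (beta_emp - beta_star) -> N(0, sigma2), i.e. Asmse = sigma2 / n *)
    cvg_dist_normal P
      (fun n w => Num.sqrt (n%:R) *
         (beta_emp Z pi_e pi_b t n (xi_hat n w) (tau_hat n w) w - beta_star))
      sigma2 /\
    (* sigma2 = min over (zeta, tau) of V zeta tau *)
    (exists zeta0 tau0, sigma2 = V zeta0 tau0) /\
    (forall zeta tau, sigma2 <= V zeta tau) /\
    (* intrinsic efficiency *)
    sigma2 <= Var P (fun w => w0 w * r0 w) /\
    sigma2 <= Var P (fun w => w0 w * (r0 w - beta_star)) /\
    (forall tau_dag : 'I_d -> R,
       sigma2 <= Var P (fun w => w0 w * r0 w
                   - Fop pi_e pi_b (model t 0 tau_dag) (x0 w) (a0 w))) /\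
    (* local efficiency *)
    (forall tau0 : 'I_d -> R,
       cond_mean_reward P (Z 0%N) (model t 0 tau0) ->
       sigma2 = Var P (fun w =>
         w0 w * (r0 w - model t 0 tau0 (x0 w) (a0 w))
         + \sum_(a' : A) model t 0 tau0 (x0 w) a' * pi_e (x0 w) a')).
Proof.
move=> polb pole overlap bw iidZ beh rR mt [Ct tC] _ Gu mxi mtau mE emax cvgE.
move=> x0 a0 r0 w0 beta_star V.
have [mZ _ _] := iidZ.
pose B k x a := Fop pi_e pi_b (basis_fn t k) x a.
pose gz k (z : X * A * R) := B k z.1.1 z.1.2.
pose qz (z : X * A * R) := weight pi_e pi_b z.1.1 z.1.2 * z.2.
pose g k w := gz k (Z 0%N w).
pose q w := qz (Z 0%N w).
have bbasis k a : bmeas (fun x => basis_fn t k x a).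
  rewrite /basis_fn; case: (unlift ord0 k) => [j|]; last exact: bmeas_cst.
  by split; [exact: mt|exists Ct => x; exact: tC].
have bB k a : bmeas (fun x => B k x a).
  by apply: Fop_bmeas => //; exact: bbasis.
have bwt a : bmeas (fun x => weight pi_e pi_b x a) by exact: weight_bmeas.
have mgz k : triple_meas_fun (gz k).
  by apply: triple_meas_fun_xa => a; case: (bB k a).
have mqz : triple_meas_fun qz.
  apply: triple_meas_fun_mul; last exact: triple_meas_fun_r.
  by apply: triple_meas_fun_xa => a; case: (bwt a).
have [Kw Kw0 wK] : exists2 K : R, 0 <= K & forall x a, `|weight pi_e pi_b x a| <= K.
  have [C wC] := bw; exists `|C| => // x a.
  have [_ b0 _] := polb; have [_ e0 _] := pole.
  by rewrite ger0_norm ?divr_ge0// (le_trans (wC x a))// ler_norm.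
have [Kg Kg0 gK] : exists2 K : R, 0 <= K & forall k z, `|gz k z| <= K.
  have HK k a : {M : R | forall x, `|B k x a| <= M} by apply: cid; case: (bB k a).
  exists (\sum_k \sum_a `|sval (HK k a)|).
    by apply: sumr_ge0 => k _; apply: sumr_ge0.
  move=> k z; apply: (le_trans (svalP (HK k z.1.2) z.1.1)).
  apply: (le_trans (ler_norm _)).
  rewrite (bigD1 k)//= (bigD1 z.1.2)//= -addrA lerDl addr_ge0//.
    exact: sumr_ge0.
  by apply: sumr_ge0 => k' _; apply: sumr_ge0.
have rK i w : `|(Z i w).2| <= `|Rmax|.
  by have /andP[r00 rm] := rR i w; rewrite ger0_norm// (le_trans rm)// ler_norm.
pose K := Kg + Kw * `|Rmax|.
have K0 : 0 <= K by rewrite addr_ge0// mulr_ge0.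
have gzK k z : `|gz k z| <= K by rewrite (le_trans (gK k z))// lerDl mulr_ge0.
have qzK i w : `|qz (Z i w)| <= K.
  rewrite /qz normrM (le_trans (ler_pM _ _ (wK _ _) (rK i w)))//.
  by rewrite /K lerDr.
have bg k : bmeas (g k).
  split; first exact: triple_meas_fun_comp (mZ 0%N) (mgz k).
  by exists K => w; exact: gzK.
have bq : bmeas q.
  split; first exact: triple_meas_fun_comp (mZ 0%N) mqz.
  by exists K => w; exact: qzK.
have bgg k l : bmeas (fun w => g k w * g l w) by exact: bmeasM.
have bqg k : bmeas (fun w => q w * g k w) by exact: bmeasM.
have Eg k : Ex P (g k) = 0.
  have := @Ex_Fop _ _ _ _ _ _ P _ (mZ 0%N) _ _ polb pole overlap bw beh (fun=> 1)
    (basis_fn t k) (bmeas_cst 1) (bbasis k).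
  by under eq_fun do rewrite mul1r.
pose G := gram P (Z 0%N) pi_e pi_b t.
have GE k l : G k l = Ex P (fun w => g k w * g l w) by rewrite mxE.
have Gs k l : G k l = G l k.
  by rewrite !GE; congr Ex; apply/funext => w; rewrite mulrC.
pose p k := Ex P (fun w => q w * g k w).
pose b k := (invmx G *m (\col_l p l)) k ord0.
have Gb l : \sum_k G l k * b k = p l.
  have := congr1 (fun M : 'cV[R]_d.+1 => M l ord0) (mulKVmx Gu (\col_l p l)).
  by rewrite !mxE => <-; apply: eq_bigr.
have blin (c : 'I_d.+1 -> R) : bmeas (fun w => \sum_k c k * g k w).
  by apply: bmeas_sum => k; exact: bmeasZ.
have Elin (c : 'I_d.+1 -> R) : Ex P (fun w => \sum_k c k * g k w) = 0.
  rewrite Ex_sum; last by move=> k; exact: bmeasZ.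
  by rewrite big1// => k _; rewrite ExZ// Eg mulr0.
pose W (c : 'I_d.+1 -> R) := Ex P (fun w => (q w - \sum_k c k * g k w) ^+ 2).
have FE zeta tau w : Fop pi_e pi_b (model t zeta tau) (x0 w) (a0 w) =
  \sum_k coef zeta tau k * g k w by rewrite Fop_model.
have VE zeta tau : V zeta tau = W (coef zeta tau) - beta_star ^+ 2.
  by congr (_ - _); congr Ex; apply/funext => w; rewrite FE.
have orthb l : Ex P (fun w => (q w - \sum_k b k * g k w) * g l w) = 0.
  under eq_fun do rewrite mulrBl mulr_suml.
  rewrite ExB//; last first.
    by apply: bmeas_sum => k; apply: bmeasM => //; exact: bmeasZ.
  rewrite Ex_sum; last by move=> k; apply: bmeasM => //; exact: bmeasZ.
  apply/eqP; rewrite subr_eq0; apply/eqP; rewrite -/(p l) -Gb.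
  apply: eq_bigr => k _; rewrite GE mulrC -ExZ//.
  by congr Ex; apply/funext => w; ring.
have Wmin := normal_equations_min bq bg orthb.
pose sigma2 := W b - beta_star ^+ 2.
have sV : sigma2 = V (b ord0) (fun j => b (lift ord0 j)) by rewrite VE coefK.
have sle zeta tau : sigma2 <= V zeta tau by rewrite VE lerD2r; exact: Wmin.
(* As F has mean zero, subtracting it leaves the mean [beta_star], so each competing variance is a
   value of [V]. *)
have VarV zeta tau : Var P (fun w => w0 w * r0 w
    - Fop pi_e pi_b (model t zeta tau) (x0 w) (a0 w)) = V zeta tau.
  rewrite /Var /V; congr (_ - _ ^+ 2).
  under eq_fun do rewrite FE.
  by rewrite (ExB P bq (blin _)) Elin subr0.
(* The influence function of [beta_emp]: its mean is zero and its second moment is [sigma2]. *)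
pose uz z := qz z - \sum_k b k * gz k z - beta_star.
pose U i w := uz (Z i w).
have muz : triple_meas_fun uz.
  apply: triple_meas_fun_add; last exact: triple_meas_fun_cst.
  apply: triple_meas_fun_add => //; apply: triple_meas_fun_opp.
  apply: triple_meas_fun_sum => k.
  exact: (triple_meas_fun_mul (triple_meas_fun_cst (b k)) (mgz k)).
have iidU : iid_bounded P U.
  apply: iid_bounded_comp iidZ muz _.
  exists (K + \sum_k `|b k| * K + `|beta_star|) => i w.
  rewrite (le_trans (ler_normB _ _))// lerD// (le_trans (ler_normB _ _))// lerD//.
  rewrite (le_trans (ler_norm_sum _ _ _))// ler_sum// => k _.
  by rewrite normrM ler_wpM2l.
have bqb : bmeas (fun w => q w - \sum_k b k * g k w) by exact: bmeasB.
have bbs : bmeas (fun _ : Om => beta_star) by exact: bmeas_cst.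
have Eqb : Ex P (fun w => q w - \sum_k b k * g k w) = beta_star.
  by rewrite ExB// Elin subr0.
have EU : Ex P (U 0%N) = 0 by rewrite (ExB P bqb bbs) Ex_cst Eqb subrr.
have EU2 : Ex P (fun w => U 0%N w ^+ 2) = sigma2.
  have := Var_shift P beta_star bqb; rewrite /Var -[X in _ - X ^+ 2 = _]/(Ex P (U 0%N)) EU Eqb.
  by rewrite expr0n subr0.
exists sigma2; split.
  rewrite -EU2; pose eta n w := coef (xi_hat n w) (tau_hat n w).
  have onepFE n w z : onepF pi_e pi_b t (xi_hat n w) (tau_hat n w) z =
      1 + \sum_k eta n w k * gz k z by rewrite /onepF Fop_model.
  have metaZ n i : measurable_fun setT
      (fun w => onepF pi_e pi_b t (xi_hat n w) (tau_hat n w) (Z i w)).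
    under eq_fun do rewrite onepFE.
    apply: measurable_funD => //; apply: measurable_sum => k.
    apply: measurable_funM; last exact: triple_meas_fun_comp (mZ i) (mgz k).
    by rewrite /eta /coef; case: (unlift ord0 k).
  have mwr i : measurable_fun setT (fun w => qz (Z i w)).
    exact: triple_meas_fun_comp (mZ i) mqz.
  have minv (f : Om -> R) : measurable_fun setT f -> measurable_fun setT (fun w => (f w)^-1).
    by move=> mf; exact: (measurableT_comp measurable_inv mf).
  have mY n : measurable_fun setT (fun w => Num.sqrt n%:R *
      (beta_emp Z pi_e pi_b t n (xi_hat n w) (tau_hat n w) w - beta_star)).
    apply: measurable_funM => //; apply: measurable_funB => //.
    rewrite /beta_emp /Emp; apply: measurable_funM => //; apply: measurable_sum => i.
    apply: measurable_funM; last exact: minv.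
    under eq_fun do rewrite -mulrA.
    apply: measurable_funM; last exact: mwr.
    apply: (minv); apply: measurable_funM => //; apply: measurable_sum => j; exact: minv.
  apply: (central_limit_slutsky iidU EU mY).
  have [C [del0 [C0 del00 expansion]]] := el_expansion K0 Gu Gs Gb.
  (* One finite index set for the three families of centred moments whose averages [el_expansion]
     wants below [Del]. *)
  pose hz (l : 'I_d.+1 + 'I_d.+1 * 'I_d.+1 + 'I_d.+1) z :=
    match l with
    | inl (inl k) => gz k z
    | inl (inr kl) => gz kl.1 z * gz kl.2 z - G kl.1 kl.2
    | inr k => qz z * gz k z - p k
    end.
  have mhz l : triple_meas_fun (hz l).
    case: l => [[k|[k l]]|k]; first exact: mgz.
    - exact: (triple_meas_fun_add (triple_meas_fun_mul (mgz k) (mgz l)) (triple_meas_fun_cst (- G k l))).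
    - exact: (triple_meas_fun_add (triple_meas_fun_mul mqz (mgz k)) (triple_meas_fun_cst (- p k))).
  have iidh l : iid_bounded P (fun i w => hz l (Z i w)).
    apply: iid_bounded_comp iidZ (mhz l) _.
    case: l => [[k|[k l]]|k]; first by exists K => i w; exact: gzK.
    - exists (K * K + `|G k l|) => i w /=.
      by rewrite (le_trans (ler_normB _ _))// lerD// normrM ler_pM.
    - exists (K * K + `|p k|) => i w /=.
      by rewrite (le_trans (ler_normB _ _))// lerD// normrM ler_pM.
  have Eh l : Ex P (fun w => hz l (Z 0%N w)) = 0.
    case: l => [[k|[k l]]|k] /=; first exact: Eg.
    - rewrite (ExB P (bgg k l) (bmeas_cst _)) Ex_cst GE subrr//.
    - rewrite (ExB P (bqg k) (bmeas_cst _)) Ex_cst subrr//.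
  (* The expansion is used with Del = sqrt Theta, which dominates every deviation. Its error C Del^2
     is then C Theta, whose mean is C v / n, and the threshold on Theta becomes [del0 ^+ 2]. *)
  pose Theta n w := \sum_l (n%:R^-1 * \sum_(i < n) hz l (Z i w)) ^+ 2.
  pose v := \sum_l Ex P (fun w => hz l (Z 0%N w) ^+ 2).
  have bmean n l : bmeas (fun w => (n%:R^-1 * \sum_(i < n) hz l (Z i w)) ^+ 2).
    by apply: bmeasX; apply: bmeasZ; apply: bmeas_sum => i; exact: iidb_bmeas (iidh l) i.
  have avgT n l w : `|avg n (fun i => hz l (Z i w))| <= Num.sqrt (Theta n w).
    rewrite -sqrtr_sqr ler_wsqrtr// /Theta (bigD1 l)//= lerDl.
    by apply: sumr_ge0 => j _; exact: sqr_ge0.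
  have T0 n w : 0 <= Theta n w by apply: sumr_ge0 => l _; exact: sqr_ge0.
  apply: (remainder_cvg0 (Theta := Theta) (E := E) (C := C) (del0 := del0 ^+ 2) (v := v)) => //.
  - exact: exprn_gt0.
  - by apply: sumr_ge0 => l _; apply: Ex_ge0 => w; exact: sqr_ge0.
  - by move=> n; exact: bmeas_sum.
  - move=> n n0; rewrite /Theta Ex_sum// /v mulr_suml; apply: eq_bigr => l _.
    by rewrite (Ex_mean_sqr (iidh l))// mulrC.
  - move=> n; apply: measurable_funB; first exact: mY.
    by case: (nsum_bmeas iidU n).
  move=> n w n0 Enw Tn.
  have [feas max] := emax n w Enw.
  have Td : Num.sqrt (Theta n w) <= del0.
    by rewrite -(ger0_norm (ltW del00)) -sqrtr_sqr ler_wsqrtr.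
  pose a i := 1 + \sum_k eta n w k * gz k (Z i w).
  have a_gt0 i : (i < n)%N -> 0 < a i by move=> ni; rewrite /a -onepFE; exact: feas.
  have foc k : \sum_(i < n) gz k (Z i w) / a i = 0.
    (* Moving the k-th coefficient by [s] adds [s * gz k] to every [a i], and positivity of the
       result is exactly feasibility. *)
    apply: (sum_ln_max_foc (u := fun i => gz k (Z i w))) => // s sfeas.
    pose c j := eta n w j + s * (j == k)%:R.
    have cE i : onepF pi_e pi_b t (c ord0) (fun j => c (lift ord0 j)) (Z i w) =
        a i + s * gz k (Z i w).
      rewrite /onepF Fop_model coefK /a -addrA; congr (_ + _).
      under eq_bigr do rewrite /c mulrDl.
      rewrite big_split/=; congr (_ + _).
      rewrite (bigD1 k)//= eqxx mulr1 big1 ?addr0// => j /negbTE ->.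
      by rewrite mulr0 mul0r.
    have cfeas : emp_feasible Z pi_e pi_b t n (c ord0) (fun j => c (lift ord0 j)) w.
      by move=> i ni; rewrite cE; exact: sfeas.
    have := max _ _ cfeas.
    rewrite /emp_loglik /Emp ler_pM2l ?invr_gt0 ?ltr0n//.
    have -> : \sum_(i < n) ln (onepF pi_e pi_b t (c ord0) (fun j => c (lift ord0 j)) (Z i w)) =
        \sum_(i < n) ln (a i + s * gz k (Z i w)) by apply: eq_bigr => i _; rewrite cE.
    have -> // : \sum_(i < n) ln (onepF pi_e pi_b t (xi_hat n w) (tau_hat n w) (Z i w)) =
        \sum_(i < n) ln (a i).
    by apply: eq_bigr => i _; rewrite onepFE.
  have avgBc h (c : R) : avg n (fun i => h i - c) = avg n h - c by rewrite avgD avg_cst.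
  have gD k l : `|avg n (fun i => gz k (Z i w) * gz l (Z i w)) - G k l| <=
      Num.sqrt (Theta n w) by rewrite -avgBc; exact: (avgT n (inl (inr (k, l))) w).
  have pD k : `|avg n (fun i => qz (Z i w) * gz k (Z i w)) - p k| <=
      Num.sqrt (Theta n w) by rewrite -avgBc; exact: (avgT n (inr k) w).
  have [c1 bound] := expansion n (fun i k => gz k (Z i w)) (fun i => qz (Z i w)) (eta n w)
    (Num.sqrt (Theta n w)) n0 (fun i k => gzK k (Z i w)) (fun i => qzK i w) a_gt0 foc
    (fun k => avgT n (inl (inl k)) w) gD pD Td.
  have betaE : beta_emp Z pi_e pi_b t n (xi_hat n w) (tau_hat n w) w =
      avg n (fun i => qz (Z i w) / a i).
    rewrite /beta_emp.
    have -> : Emp Z n (fun z => (onepF pi_e pi_b t (xi_hat n w) (tau_hat n w) z)^-1) w = 1.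
      by rewrite -[RHS]c1; congr (_ * _); apply: eq_bigr => i _; rewrite onepFE.
    by congr (_ * _); apply: eq_bigr => i _; rewrite onepFE invr1 mul1r.
  have sn0 : 0 < Num.sqrt n%:R :> R by rewrite sqrtr_gt0 ltr0n.
  have nsumE : nsum U n w = Num.sqrt n%:R * avg n (fun i => U i w).
    rewrite /nsum /avg mulrA; congr (_ * _).
    have -> : n%:R = Num.sqrt n%:R ^+ 2 :> R by rewrite sqr_sqrtr.
    by rewrite sqrtr_sqr ger0_norm ?(ltW sn0)//; field; rewrite gt_eqF.
  have avgU : avg n (fun i => U i w) =
      avg n (fun i => qz (Z i w)) - \sum_k b k * avg n (fun i => gz k (Z i w)) - beta_star.
    rewrite /U /uz avgBc; congr (_ - _).
    rewrite avgD; congr (_ + _); under eq_fun do rewrite -mulN1r.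
    rewrite avgZ avg_sum mulN1r; congr (- _); apply: eq_bigr => k _.
    by rewrite avgZ.
  have -> : Num.sqrt n%:R * (beta_emp Z pi_e pi_b t n (xi_hat n w) (tau_hat n w) w - beta_star)
      - nsum U n w = Num.sqrt n%:R * (avg n (fun i => qz (Z i w) / a i) -
      (avg n (fun i => qz (Z i w)) - \sum_k b k * avg n (fun i => gz k (Z i w)))).
    by rewrite nsumE avgU betaE; ring.
  rewrite normrM gtr0_norm// ler_wpM2l ?(ltW sn0)//.
  by rewrite sqr_sqrtr in bound.
split; first by exists (b ord0), (fun j => b (lift ord0 j)).
split=> //.
have F0 w : Fop pi_e pi_b (model t 0 (fun=> 0)) (x0 w) (a0 w) = 0.
  rewrite FE big1// => k _; rewrite /coef; case: (unlift ord0 k) => [j|]; exact: mul0r.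
split.
  have := sle 0 (fun=> 0); rewrite -VarV; under eq_fun do rewrite F0 subr0.
  by [].
split.
  (* The constant model gives w r - F(beta_star) = w (r - beta_star) + beta_star, so the SNIS
     variance is a value of [V] up to a constant shift. *)
  have F1 w : Fop pi_e pi_b (model t beta_star (fun=> 0)) (x0 w) (a0 w) = beta_star * (w0 w - 1).
    have [_ _ e1] := pole.
    have betaE x a : model t beta_star (fun=> 0) x a = beta_star.
      by rewrite /model big1 ?addr0// => j _; rewrite mul0r.
    rewrite /Fop betaE; under eq_bigr do rewrite betaE.
    by rewrite -mulr_sumr e1 /w0; ring.
  have := sle beta_star (fun=> 0); rewrite -VarV -(Var_shift P beta_star); last first.
    by under eq_fun do rewrite FE; exact: bmeasB.
  congr (_ <= Var P _); apply/funext => w; rewrite F1; ring.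
split; first by move=> tau_dag; rewrite VarV.
move=> tau0 cond.
have -> : (fun w => w0 w * (r0 w - model t 0 tau0 (x0 w) (a0 w))
    + \sum_(a' : A) model t 0 tau0 (x0 w) a' * pi_e (x0 w) a') =
    (fun w => w0 w * r0 w - Fop pi_e pi_b (model t 0 tau0) (x0 w) (a0 w)).
  by apply/funext => w; rewrite /Fop -/(w0 w); ring.
rewrite VarV; apply/eqP; rewrite eq_le sle/= VE lerD2r.
apply: normal_equations_min => // l.
have bmod a : bmeas (fun x => model t 0 tau0 x a).
  apply: bmeasD; first exact: bmeas_cst.
  by apply: bmeas_sum => j; apply: bmeasZ; split; [exact: mt|exists Ct => x; exact: tC].
have br : bmeas r0.
  split; first exact: triple_meas_fun_comp (mZ 0%N) triple_meas_fun_r.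
  by exists `|Rmax| => w; exact: rK.
have bk a : bmeas (fun x => weight pi_e pi_b x a * B l x a) by exact: bmeasM.
pose S x := \sum_(a' : A) model t 0 tau0 x a' * pi_e x a'.
have bS : bmeas S.
  by apply: bmeas_sum => a; apply: bmeasM => //; exact: policy_bmeas.
(* The residual is w (r - Q) + S(x). Against g_l the first part has mean zero by the conditional
   mean of the reward; the second does because S depends on the context alone, given which g_l has
   mean zero. *)
have resE w : (q w - \sum_k coef 0 tau0 k * g k w) * g l w =
    (r0 w - model t 0 tau0 (x0 w) (a0 w)) * (weight pi_e pi_b (x0 w) (a0 w) * B l (x0 w) (a0 w))
    + S (x0 w) * B l (x0 w) (a0 w).
  by rewrite -FE /Fop -/(S (x0 w)) /q /qz /g /gz -/(x0 w) -/(a0 w) -/(r0 w); ring.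
under eq_fun do rewrite resE.
rewrite ExD; last 2 first.
- apply: bmeasM; first by apply: bmeasB => //; exact: (bmeas_context_action (mZ 0%N) bmod).
  exact: (bmeas_context_action (mZ 0%N) bk).
- apply: bmeasM; first exact: (bmeas_context (mZ 0%N) bS).
  exact: (bmeas_context_action (mZ 0%N) (bB l)).
rewrite (Ex_reward_residual (mZ 0%N) cond br bmod bk) add0r.
exact: (Ex_Fop (mZ 0%N) polb pole overlap bw beh bS (bbasis l)).
Qed.
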